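(* Let $G$ be a plane graph that is generically rigid in the plane. Then the angles of $G$ can be labelled so that the labelling is a combinatorial pseudo-triangulation labelling (CPT-labelling) satisfying the generalized Laman condition.
   Context: Graphs are finite and simple. A plane graph is a graph with a given non-crossing topological embedding in the plane. A graph is generically rigid in the plane if any generically embedded bar-and-joint framework in $\mathbb{R}^2$ corresponding to it has no non-trivial infinitesimal motions. An angle of a plane graph is a pair of consecutive edges in the cyclic order around a vertex (equivalently, a vertex-face incidence, counted with multiplicity). A CPT-labelling assigns ''big'' or ''small'' to every angle such that every bounded face has exactly three small angles, all angles in the unbounded face are big, and no vertex is incident to more than one big angle. A vertex is pointed if it is incident to a big angle, non-pointed otherwise. A CPT-labelling satisfies the generalized Laman condition if every subset of $x$ non-pointed plus $y$ pointed vertices, with $x+y\ge 2$, induces a subgraph with at most $3x+2y-3$ edges. *)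

(* Defs.v *)
From HB Require Import structures.
From mathcomp Require Import -(notations) mpoly.
From mathcomp Require Import all_boot all_order all_algebra.
From mathcomp Require Import fingroup perm reals.

Set Implicit Arguments.
Unset Strict Implicit.
Unset Printing Implicit Defensive.

Import GRing.Theory Num.Theory.

Record sgraph := SGraph {
  vertex :> finType;
  adj : rel vertex;
  adj_sym : symmetric adj;
  adj_irr : irreflexive adj }.

Definition induced_edges (G : sgraph) (A : {set G}) : {set {set G}} :=
  [set [set uv.1; uv.2] | uv : G * G &
    [&& uv.1 \in A, uv.2 \in A & adj uv.1 uv.2]].

(** ** Generic rigidity in the plane *)

Section Rigidity.
Local Open Scope ring_scope.

Definition framework (R : realType) (G : sgraph) := G -> 'rV[R]_2.

(* The 2|V| coordinates are algebraically independent over the rationals. *)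
Definition generic (R : realType) (G : sgraph) (p : framework R G) : Prop :=
  forall f : mpoly #|{: G * 'I_2}| rat, f != 0 ->
    mmap ratr
      (fun k : 'I_#|{: G * 'I_2}| => p (enum_val k).1 0 (enum_val k).2) f != 0.

Definition infinitesimal_motion (R : realType) (G : sgraph)
    (p m : G -> 'rV[R]_2) : Prop :=
  forall u v : G, adj u v -> (p u - p v) *m (m u - m v)^T = 0.

(* Velocity fields of one-parameter families of isometries of the plane: a
   translation plus an infinitesimal rotation (skew-symmetric matrix). *)
Definition trivial_motion (R : realType) (G : sgraph)
    (p m : G -> 'rV[R]_2) : Prop :=
  exists (t : 'rV[R]_2) (S : 'M[R]_2),
    S^T = - S /\ forall v : G, m v = t + p v *m S.

Definition generically_rigid (R : realType) (G : sgraph) : Prop :=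
  forall p : framework R G, generic p ->
  forall m : G -> 'rV[R]_2, infinitesimal_motion p m -> trivial_motion p m.

End Rigidity.

(** ** Plane graphs

   A non-crossing embedding in the plane is recorded by its combinatorial map:
   the counterclockwise cyclic order of the edges around each vertex, together
   with the choice of the unbounded face. A dart is an edge with a direction;
   it stands for the end of that edge at its source. *)

Definition dart (G : sgraph) := {uv : G * G | adj uv.1 uv.2}.
HB.instance Definition _ (G : sgraph) := Finite.on (dart G).

Definition source (G : sgraph) (d : dart G) : G := (sval d).1.

Lemma opposite_subproof (G : sgraph) (d : dart G) :
  adj (sval d).2 (sval d).1.
Proof. by rewrite adj_sym; exact: (svalP d). Qed.

Definition opposite (G : sgraph) (d : dart G) : dart G :=
  exist (fun uv : G * G => adj uv.1 uv.2)
    ((sval d).2, (sval d).1) (opposite_subproof d).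

(* If [rot d] is the dart following [d] counterclockwise around the source of
   [d], then [next_on_face rot d] is the dart following [d] on the boundary
   of the face lying to the left of [d]. *)
Definition next_on_face (G : sgraph) (rot : {perm dart G}) (d : dart G) :
  dart G := (rot^-1)%g (opposite d).

Definition facial_walks (G : sgraph) (rot : {perm dart G}) :
    {set {set dart G}} :=
  [set [set d' | fconnect (next_on_face rot) d d'] | d : dart G].

(* [rot_euler] is V + F = E + 2C, which says that every component is embedded
   in a surface of genus 0. An isolated vertex has no dart, so the empty facial
   walk around it has to be counted separately.
   When the graph is connected, facial walks are the boundaries of the faces.
   If there is no dart, then [outer] is the empty set; this covers the graph
   with a single vertex, whose only face is the unbounded one. *)
Record plane_graph := PlaneGraph {
  pgraph :> sgraph;
  rot : {perm dart pgraph};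
  rot_cyclic : forall d d' : dart pgraph,
    fconnect rot d d' = (source d == source d');
  rot_euler :
    #|pgraph|
      + (#|facial_walks rot| + #|[set v : pgraph | [forall w, ~~ adj v w]]|)
    = #|induced_edges [set: pgraph]| + 2 * n_comp (@adj pgraph) pgraph;
  outer : {set dart pgraph};
  outer_face : 0 < #|{: dart pgraph}| -> outer \in facial_walks rot }.

Definition faces (G : plane_graph) : {set {set dart G}} :=
  facial_walks (@rot G).

(* The dart [d] also names the angle from [d] to [rot d], at the source of [d].
   This angle lies in the face to the left of [d], so the angles of a face are
   the darts of its facial walk; a face visiting a vertex several times has
   several angles there, and the end of a pendant edge carries one angle. *)
Notation angle G := (dart (pgraph G)).

(** ** Labellings; [lab a] is [true] if the angle [a] is big, [false] if it is
    small *)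

Definition CPT_labelling (G : plane_graph) (lab : angle G -> bool) : Prop :=
  [/\ forall F : {set angle G}, F \in faces G -> F != outer G ->
        #|[set a in F | ~~ lab a]| = 3,
      forall a : angle G, a \in outer G -> lab a
    & forall v : G, #|[set a : angle G | (source a == v) && lab a]| <= 1].

Definition pointed (G : plane_graph) (lab : angle G -> bool) (v : G) : bool :=
  [exists a : angle G, (source a == v) && lab a].

(* The subtraction is never truncated, since 3x + 2y >= 4. *)
Definition generalized_Laman (G : plane_graph) (lab : angle G -> bool) : Prop :=
  forall A : {set G},
    let x := #|[set v in A | ~~ pointed lab v]| in
    let y := #|[set v in A | pointed lab v]| in
    2 <= x + y -> #|induced_edges A| <= 3 * x + 2 * y - 3.

(* Main.v *)
Require Import Defs.
From mathcomp Require Import -(notations) mpoly.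
From mathcomp Require Import all_boot all_order all_algebra fingroup perm reals.
From mathcomp Require boolp classical_sets cardinality set_interval.
From mathcomp Require constructive_ereal measure lebesgue_measure.
From mathcomp Require Import zify ring lra.

Set Implicit Arguments.
Unset Strict Implicit.
Unset Printing Implicit Defensive.
Import Order.TTheory GRing.Theory Num.Theory.

(** A labelling is a set [N] of angles, the big ones, that contains all the
    angles of the outer face, all but three angles of each bounded face, and at
    most one angle at each vertex. Fix a generic framework and let [r] be the
    rank function of its rigidity matrix. For a set [A] of vertices let [nu A]
    be the number of edges induced by [A] minus their rank, that is, the
    dimension of the space of self-stresses on [A]. That rank is at most
    [2|A| - 3], so the generalized Laman condition holds as soon as every [A]
    contains at least [nu A] non-pointed vertices. Now [nu] is supermodular, so
    the sets [Y] of vertices with [|A \ Y| >= nu A] for all [A] are the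
    independent sets of a matroid, whose rank at [Z] is the minimum over [A] of
    [|A u Z| - nu A]. What is wanted is therefore a choice of representatives
    for the faces (each face counted as often as it demands big angles) which
    are independent in this matroid, and Rado's theorem says when one exists:
    for every set [S] of faces, with set of vertices [V(S)], and for every [A],
      [demand of S + nu A <= |A u V(S)|].
    This is [Rado_transversal], applied in [Rado_condition_faces].

    By Euler's formula and [r(E) >= 2|V| - 3], which is what rigidity gives,
    this condition on [S] becomes an upper bound for the increase of [r] when
    the edges on the complement [T] of [S] are added to the edges within [A].
    That bound is [region_rank]. It is additive over the pieces of [T] that are
    connected across edges not within [A], so let [T] be such a piece. Then it
    is a combination of
    - two Euler inequalities, dual to each other, for the vertices and edges on
      [T] ([region_euler_edges]) and for the vertices outside [A] surrounded by
      [T] ([region_euler_inner]);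
    - the bound [2v - 3] for the rank of all the edges on [T];
    - the independence of the edges on [T] that lie within [A]
      ([boundary_independent]).

    The last point is where planarity and genericity meet. A self-stress [lam]
    on those edges, multiplied by the edge vectors, is a vector-valued cycle.
    A planar map has no homology, so the cycle is the boundary of a function on
    the faces: this is Maxwell's reciprocal diagram. The function can be taken
    to be zero on [T], since [T] is connected across unstressed edges, and every
    stressed edge has a side in [T]. If it takes a value [w <> 0] on a face
    next to a stressed edge, turning around an end of that edge through the
    faces of value [w] leads to a second stressed edge at the same vertex, and
    both edges are parallel to [w], which is impossible in generic position. *)

(** * Transversals saturating prescribed demands *)

Section Transversal.

Variables (D V I : finType) (src : D -> V) (cls : D -> I).
Variables (c : I -> nat) (nu : {set V} -> nat).
Hypothesis nu_supermodular : forall A B : {set V},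
  nu A + nu B <= nu (A :|: B) + nu (A :&: B).

Definition fiber (N : {set D}) (S : {set I}) := [set d in N | cls d \in S].

(** [|A :|: Z| - nu A], minimised over [A], is the rank of [Z] in the matroid
    that [nu] defines. Quantifying over [A] avoids introducing that rank. *)
Definition Rado_condition (N : {set D}) := [forall S : {set I}, forall A : {set V},
  \sum_(i in S) c i + nu A <= #|A :|: src @: fiber N S|].

Lemma Rado_conditionP (N : {set D}) : reflect (forall (S : {set I}) (A : {set V}),
  \sum_(i in S) c i + nu A <= #|A :|: src @: fiber N S|) (Rado_condition N).
Proof.
apply: (iffP forallP) => [h S A | h S]; first by have /forallP/(_ A) := h S.
by apply/forallP => A; apply: h.
Qed.

(** If no angle of [i] can be dropped, each of them has a violated condition
    whose set of classes contains [i]. Uncrossing these conditions one after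
    another gives a single one from which all of [B] is missing and whose
    deficiency is at least [#|B|]. *)
Lemma deficient_uncrossing (N : {set D}) (i : I) :
  Rado_condition N ->
  (forall d, d \in fiber N [set i] -> ~~ Rado_condition (N :\ d)) ->
  forall B : {set D}, B != set0 -> B \subset fiber N [set i] ->
  exists (S : {set I}) (A : {set V}), i \in S /\
    #|A :|: src @: (fiber N S :\: B)| + #|B| <= \sum_(i in S) c i + nu A.
Proof.
move=> /Rado_conditionP NP bad.
have one d : d \in fiber N [set i] -> exists (S : {set I}) (A : {set V}), i \in S /\
    #|A :|: src @: (fiber N S :\ d)| + 1 <= \sum_(i in S) c i + nu A.
  move=> dN; move: (bad d dN); rewrite negb_forall => /existsP[S].
  rewrite negb_forall => /existsP[A]; rewrite -ltnNge => lt; exists S, A.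
  have eqf : fiber (N :\ d) S = fiber N S :\ d.
    by apply/setP => x; rewrite !inE andbA.
  rewrite eqf in lt; split; last by rewrite addn1.
  apply: contraLR lt => iS; rewrite -leqNgt.
  have -> : fiber N S :\ d = fiber N S; last exact: NP.
  apply/setP => x; rewrite !inE; case: eqP => //= ->.
  by move: dN; rewrite !inE => /andP[_ /eqP->]; rewrite (negbTE iS) andbF.
move=> B; have [k] := ubnP #|B|; elim: k B => // k IH B ltk B0 BN.
have [d dB] := set0Pn _ B0; have dN := subsetP BN d dB.
have [S1 [A1 [iS1 h1]]] := one d dN.
have [B1|B1] := eqVneq (B :\ d) set0.
  exists S1, A1; split=> //.
  have -> : B = [set d].
    by rewrite -(setD1K dB) B1 setU0.
  by rewrite cards1.
have [||S2 [A2 [iS2 h2]]] := IH _ _ B1.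
- by move: ltk; rewrite (cardsD1 d) dB.
- by apply: subset_trans BN; apply: subsetDl.
exists (S1 :&: S2), (A1 :&: A2); split; first by rewrite inE iS1.
have sumUI : \sum_(j in S1) c j + \sum_(j in S2) c j =
    \sum_(j in S1 :|: S2) c j + \sum_(j in S1 :&: S2) c j.
  have E (S : {set I}) : \sum_(j in S) c j = \sum_j c j * (j \in S).
    by rewrite big_mkcond; apply: eq_bigr => j _; case: ifP; rewrite ?muln1 ?muln0.
  rewrite !E -!big_split /=; apply: eq_bigr => j _; rewrite !inE.
  by do 2!case: (_ \in _); rewrite ?muln0 ?addn0 ?add0n.
have hU := NP (S1 :|: S2) (A1 :|: A2).
have hnu := nu_supermodular A1 A2.
have cB : #|B| = (#|B :\ d|).+1 by rewrite (cardsD1 d) dB.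
set Z1 := A1 :|: _ in h1; set Z2 := A2 :|: _ in h2.
have lU : #|A1 :|: A2 :|: src @: fiber N (S1 :|: S2)| <= #|Z1 :|: Z2|.
  apply/subset_leq_card/subsetP => v; rewrite !in_setU => /orP[/orP[->|->]|].
  - by [].
  - by rewrite !orbT.
  move=> /imsetP[x xN ->].
  have [xd|xd] := boolP (x == d).
    suff -> : src x \in src @: (fiber N S2 :\: (B :\ d)) by rewrite !orbT.
    apply: imset_f; move: dN; rewrite (eqP xd) !inE eqxx /= => /andP[-> /eqP->].
    by rewrite iS2.
  have [xS1|xS1] := boolP (cls x \in S1).
    suff -> : src x \in src @: (fiber N S1 :\ d) by rewrite !orbT.
    by apply: imset_f; move: xN; rewrite !inE xd xS1 /= => /andP[->].
  suff -> : src x \in src @: (fiber N S2 :\: (B :\ d)) by rewrite !orbT.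
  apply: imset_f; move: xN; rewrite !inE xd (negbTE xS1) /= => /andP[-> ->].
  rewrite !andbT; apply: contra xS1 => xB.
  by have := subsetP BN x xB; rewrite !inE => /andP[_ /eqP->].
have lI : #|A1 :&: A2 :|: src @: (fiber N (S1 :&: S2) :\: B)| <= #|Z1 :&: Z2|.
  apply/subset_leq_card/subsetP => v; rewrite in_setU in_setI.
  case/orP => [/andP[v1 v2]|]; first by rewrite !inE v1 v2.
  case/imsetP => x; rewrite !inE => /andP[xB /andP[xN /andP[x1 x2]]] ->.
  have xd : x != d by apply: contraNneq xB => ->.
  apply/andP; split; apply/orP; right; apply: imset_f; rewrite !inE.
    by rewrite xd xN.
  by rewrite negb_and xB orbT xN.
have := cardsUI Z1 Z2.
lia.
Qed.

(** Rado's proof of his theorem: take a minimal [N] satisfying the condition. If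
    a class [i] had more than [c i] elements in [N], the previous lemma, applied
    to all of them, would violate the condition for [S :\ i]. *)
Lemma Rado_transversal : nu set0 = 0 -> Rado_condition setT ->
  exists2 N : {set D}, Rado_condition N & forall i, #|fiber N [set i]| = c i.
Proof.
move=> nu0 hT.
have [N /minsetP[RN minN] _] := @minset_exists _ Rado_condition setT hT.
exists N => // i; apply/eqP; rewrite eqn_leq; apply/andP; split; last first.
  have /Rado_conditionP/(_ [set i] set0) := RN.
  rewrite big_set1 set0U => h; apply: leq_trans (leq_imset_card src _).
  exact: leq_trans (leq_addr _ _) h.
rewrite leqNgt; apply/negP => ltc.
have bad d : d \in fiber N [set i] -> ~~ Rado_condition (N :\ d).
  rewrite inE => /andP[dN _]; apply/negP => R'.
  by have := minN _ R' (subsetDl _ _) => /setP/(_ d); rewrite !inE eqxx dN.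
have [||S [A [iS h]]] := deficient_uncrossing RN bad (B := fiber N [set i]).
- by rewrite -card_gt0; apply: leq_trans ltc.
- by [].
have /Rado_conditionP/(_ (S :\ i) A) := RN.
have -> : fiber N (S :\ i) = fiber N S :\: fiber N [set i].
  by apply/setP => x; rewrite !inE; case: (x \in N); case: eqP.
by rewrite (big_setD1 i iS) /= in h; lia.
Qed.
End Transversal.

(** * Cycles and boundaries of a combinatorial map *)

Section Incidence.
Local Open Scope ring_scope.
(* [D] is the set of darts. [E0] contains one dart of each edge and serves as
   the set of edges. *)
Variables (F : fieldType) (D : finType) (opp : D -> D) (E0 : {set D}).
Hypothesis opp_inv : involutive opp.
Hypothesis opp_E0 : forall d, (opp d \in E0) = (d \notin E0).

Definition incidence (T : finType) (c : D -> T) (d : D) (t : T) : F :=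
  (c d == t)%:R - (c (opp d) == t)%:R.

Definition incidence_mx (T : finType) (c : D -> T) (P : {set T}) (J : {set D}) :
    'M[F]_(#|P|, #|J|) :=
  \matrix_(i, j) incidence c (enum_val j) (enum_val i).

(** Every nonempty set of cells chosen from [P] is joined to its complement by
    an edge of [J]. Equivalently, in the graph with edges [J] every component
    leaves [P], so that the rows of the incidence matrix are independent. *)
Definition exits (T : finType) (c : D -> T) (J : {set D}) (P : {set T}) : Prop :=
  forall P1 : {set T}, P1 \subset P -> P1 != set0 ->
  exists2 d, d \in J & (c d \in P1) != (c (opp d) \in P1).

Definition extend0 (T : finType) (P : {set T}) (x : 'rV[F]_#|P|) (t : T) : F :=
  \sum_i x 0 i * (enum_val i == t)%:R.

Lemma extend0_val (T : finType) (P : {set T}) (x : 'rV[F]_#|P|) i :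
  extend0 x (enum_val i) = x 0 i.
Proof.
rewrite /extend0 (bigD1 i) //= eqxx mulr1 big1 ?addr0 // => j ji.
by rewrite (inj_eq enum_val_inj) (negbTE ji) mulr0.
Qed.

Lemma extend0_out (T : finType) (P : {set T}) (x : 'rV[F]_#|P|) t :
  t \notin P -> extend0 x t = 0.
Proof.
move=> tP; rewrite /extend0 big1 // => i _; case: eqP => [e|]; last by rewrite mulr0.
by move: tP; rewrite -e enum_valP.
Qed.

Lemma mul_incidence_mx (T : finType) (c : D -> T) (P : {set T}) (J : {set D})
    (x : 'rV[F]_#|P|) j :
  (x *m incidence_mx c P J) 0 j = extend0 x (c (enum_val j)) - extend0 x (c (opp (enum_val j))).
Proof.
rewrite mxE -sumrB; apply: eq_bigr => i _; rewrite mxE /incidence.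
by rewrite ![_ == enum_val i]eq_sym mulrBr.
Qed.

(** The set of cells where [y] has a given nonzero value lies in [P] and has no
    exit. *)
Lemma exits_vanish (T : finType) (c : D -> T) (J : {set D}) (P : {set T})
    (y : T -> F) : exits c J P -> (forall t, t \notin P -> y t = 0) ->
  (forall d, d \in J -> y (c d) = y (c (opp d))) -> forall t, y t = 0.
Proof.
move=> sep y0 yJ t; apply/eqP; apply: contraT => yt.
have [|//|d dJ] := sep [set s | y s == y t].
- apply/subsetP => s; rewrite inE => /eqP ys; apply: contraT => /y0 ys0.
  by rewrite -ys ys0 eqxx in yt.
- by apply/set0Pn; exists t; rewrite inE.
by rewrite !inE yJ // eqxx.
Qed.

Lemma incidence_mx_free (T : finType) (c : D -> T) (P : {set T}) (J : {set D}) :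
  exits c J P -> row_free (incidence_mx c P J).
Proof.
move=> sep; rewrite -kermx_eq0; apply/rowV0P => x /sub_kermxP xM0.
apply/rowP => i; rewrite mxE -extend0_val.
apply: (exits_vanish sep) => [t|d dJ]; first exact: extend0_out.
have /rowP/(_ (enum_rank_in dJ d)) := xM0; rewrite mul_incidence_mx mxE enum_rankK_in //.
by move/eqP; rewrite subr_eq0 => /eqP.
Qed.

(* Two applications are intended: [c1] is the source of a dart, [c2] its face and
   [rho] the clockwise rotation; or [c1] is the face, [c2] the source and [rho]
   the next dart on the face. *)
Variables (T1 T2 : finType) (c1 : D -> T1) (c2 : D -> T2) (rho : D -> D).
Hypothesis rho_inj : injective rho.
Hypothesis rho_c1 : forall d, c1 (rho d) = c1 d.
Hypothesis rho_c2 : forall d, c2 (opp d) = c2 (rho d).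

Definition star_in (P : {set T1}) (J : {set D}) : Prop :=
  forall d, c1 d \in P -> (d \in J) || (opp d \in J).

(** The boundary of a boundary is zero: on the closed walk formed by the darts of
    a [c1]-cell, [c2] returns to its initial value. *)
Lemma incidence_mx_orth (P : {set T1}) (Q : {set T2}) (J : {set D}) :
  J \subset E0 -> star_in P J -> incidence_mx c1 P J *m (incidence_mx c2 Q J)^T = 0.
Proof.
move=> JE starP; apply/matrixP => i k; rewrite !mxE.
pose s := enum_val i; pose t := enum_val k.
have sP : s \in P by apply: enum_valP.
rewrite (eq_bigr (fun j => incidence c1 (enum_val j) s * incidence c2 (enum_val j) t)); last first.
  by move=> j _; rewrite !mxE.
rewrite -(big_enum_val (A := mem J) (fun d => incidence c1 d s * incidence c2 d t)) /=.
(* The edges at [s] are all in [J], so the sum may run over all edges. *)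
have -> : \sum_(d in J) incidence c1 d s * incidence c2 d t = \sum_(d in E0) incidence c1 d s * incidence c2 d t.
  rewrite big_mkcond [RHS]big_mkcond /=; apply: eq_bigr => d _.
  case: ifP => [/(subsetP JE)->//|dJ]; case: ifP => // dE.
  have oJ : opp d \notin J.
    by apply: contraL dE => /(subsetP JE); rewrite opp_E0.
  rewrite /incidence.
  have -> : (c1 d == s) = false.
    apply/negP => /eqP e; have := starP d; rewrite e dJ (negbTE oJ) /=.
    by move/(_ sP).
  have -> : (c1 (opp d) == s) = false.
    apply/negP => /eqP e; have := starP (opp d).
    by rewrite e opp_inv dJ (negbTE oJ) /= => /(_ sP).
  by rewrite subrr mul0r.
(* Splitting the first factor turns it into a sum over the darts of [s]. *)
have -> : \sum_(d in E0) incidence c1 d s * incidence c2 d t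
   = \sum_(d in E0) (c1 d == s)%:R * incidence c2 d t
     + \sum_(d in E0) (c1 (opp d) == s)%:R * incidence c2 (opp d) t.
  rewrite -big_split /=; apply: eq_bigr => d _; rewrite /incidence opp_inv.
  by rewrite mulrBl -[X in _ = _ + _ * X]opprB mulrN.
have -> : \sum_(d in E0) (c1 (opp d) == s)%:R * incidence c2 (opp d) t =
          \sum_(d | d \notin E0) (c1 d == s)%:R * incidence c2 d t.
  rewrite [RHS](reindex_inj (inv_inj opp_inv)) /=; apply: eq_bigl => d.
  by rewrite opp_E0 negbK.
rewrite -[LHS](bigID (mem E0) predT (fun d => (c1 d == s)%:R * incidence c2 d t)) /=.
under eq_bigr do rewrite /incidence mulrBr.
rewrite sumrB [X in X - _](reindex_inj rho_inj) /=.
under eq_bigr do rewrite rho_c1.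
by under [X in _ - X]eq_bigr do rewrite rho_c2; rewrite subrr.
Qed.

(** Two orthogonal families of independent vectors in the space of dimension
    [#|J|]. For vertices and faces this is one half of Euler's formula, valid in
    every genus. *)
Lemma incidence_count (P : {set T1}) (Q : {set T2}) (J : {set D}) :
  J \subset E0 -> star_in P J -> exits c1 J P -> exits c2 J Q ->
  (#|P| + #|Q| <= #|J|)%N.
Proof.
move=> JE sP /incidence_mx_free/eqP e1 /incidence_mx_free/eqP e2.
have := mulmx0_rank_max (incidence_mx_orth Q JE sP).
by rewrite mxrank_tr e1 e2.
Qed.

(** If the count is tight, as it is in genus 0, the boundaries fill the space of
    cycles. *)
Lemma cycle_is_boundary (P : {set T1}) (Q : {set T2}) (z : 'rV_#|E0|) :
  star_in P E0 -> exits c1 E0 P -> exits c2 E0 Q -> (#|P| + #|Q| = #|E0|)%N ->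
  z *m (incidence_mx c1 P E0)^T = 0 -> (z <= incidence_mx c2 Q E0)%MS.
Proof.
move=> sP x1 x2 cnt z0.
have e1 := eqP (incidence_mx_free x1); have e2 := eqP (incidence_mx_free x2).
have orth : incidence_mx c2 Q E0 *m (incidence_mx c1 P E0)^T = 0.
  apply: trmx_inj; rewrite trmx_mul trmxK trmx0; exact: incidence_mx_orth.
apply: submx_trans (_ : kermx (incidence_mx c1 P E0)^T <= _)%MS; first exact/sub_kermxP.
have le : (incidence_mx c2 Q E0 <= kermx (incidence_mx c1 P E0)^T)%MS by apply/sub_kermxP.
rewrite -(geq_leqif (mxrank_leqif_sup le)) mxrank_ker mxrank_tr e1 e2.
by rewrite -cnt addKn.
Qed.

End Incidence.

(** * Generic frameworks *)

Module AlgebraicIndependence.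
Import boolp classical_sets cardinality set_interval.
Import constructive_ereal measure lebesgue_measure.

Section Generic.
Local Open Scope ring_scope.
Variable R : realType.

Lemma muni_neq0 n (f : mpoly n.+1 rat) : f != 0 -> muni f != 0.
Proof.
move=> f0; have /hasP[m0 m0f _] : has predT (msupp f).
  by rewrite has_predT lt0n size_eq0 msupp_eq0.
pose r (m : multinom n.+1) : multinom n :=
  Multinom [tuple m (widen_ord (leqnSn n) i) | i < n].
apply/eqP => /polyP/(_ (m0 ord_max)); rewrite muniE coef0 coef_sum => /mpolyP/(_ (r m0)).
rewrite mcoeff0 raddf_sum /= (bigD1_seq m0) ?msupp_uniq //= big1_seq.
  rewrite addr0 coefZ coefXn eqxx mulr1 mcoeffZ mcoeffX eqxx mulr1.
  by apply/eqP; rewrite -mcoeff_msupp.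
move=> m /andP[mm _]; rewrite coefZ coefXn.
have [e|] := eqVneq (m0 ord_max) (m ord_max); last by rewrite mulr0 mcoeff0.
rewrite mulr1 mcoeffZ mcoeffX; have [e'|] := eqVneq; last by rewrite mulr0.
case/eqP: mm; apply/mnmP => i.
have [j ->|->] := unliftP ord_max i; last by [].
have /mnmP/(_ j) := e'; rewrite !mnmE.
by congr (_ = _); congr (_ _); apply: val_inj; rewrite /= /bump leqNgt ltn_ord.
Qed.

Definition snoc n (h : 'I_n -> R) (y : R) (i : 'I_n.+1) : R :=
  if unlift ord_max i is Some j then h j else y.

Lemma mmap_snoc n (h : 'I_n -> R) (y : R) (f : mpoly n.+1 rat) :
  mmap ratr (snoc h y) f = (map_poly (mmap ratr h) (muni f)).[y].
Proof.
rewrite muniE raddf_sum /= horner_sum {1}/mmap; apply: eq_bigr => m _.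
rewrite map_polyZ /= hornerZ map_polyXn hornerXn mmapZ mmapX -[RHS]mulrA.
suff -> : mmap1 (snoc h y) m = mmap1 h (Multinom
    [tuple m (widen_ord (leqnSn n) i) | i < n]) * y ^+ m ord_max by [].
rewrite /mmap1 big_ord_recr /= {2}/snoc unlift_none; congr (_ * _).
apply: eq_bigr => i _; rewrite mnmE.
have -> : widen_ord (leqnSn n) i = lift ord_max i.
  by apply: val_inj; rewrite /= /bump leqNgt ltn_ord.
by rewrite /snoc liftK.
Qed.

Definition mpoly_of_seq n (s : seq (rat * multinom n)) : mpoly n rat :=
  \sum_(t <- s) t.1 *: mpolyX rat t.2.

Lemma mpoly_of_seq_surj n (f : mpoly n rat) : exists s, f = mpoly_of_seq s.
Proof.
exists [seq (mcoeff m f, m) | m <- msupp f].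
by rewrite /mpoly_of_seq big_map; exact: mpolyE.
Qed.

Lemma finite_roots (q : {poly R}) : q != 0 -> finite_set [set y | root q y]%classic.
Proof.
move=> q0; apply: contrapT => /(infinite_set_fset (size q))[B subB leB].
have := max_poly_roots q0 (rs := finmap.enum_fset B).
rewrite ltnNge leB; suff [-> ->] : all (root q) (finmap.enum_fset B) /\ uniq (finmap.enum_fset B).
  by move=> /(_ isT isT).
split; last exact: finmap.fset_uniq.
by apply/allP => y yB; apply: subB.
Qed.

(** Countable sets of reals are negligible for the Lebesgue measure. *)
Lemma countable_avoid (A : set R) : countable A -> exists y, ~ A y.
Proof.
move=> cA; apply: contrapT => nA.
have AT : A = setT.
  by apply/seteqP; split=> // y _; apply: contrapT => Ay; apply: nA; exists y.
have := countable_lebesgue_measure0 cA; rewrite AT => m0.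
have : (lebesgue_measure [set` `[0, 1]%R] <= lebesgue_measure [set: R])%E.
  by apply: le_measure; rewrite ?inE.
rewrite m0 lebesgue_measure_itv /= lte_fin ltr01 oppr0 adde0.
by rewrite lee_fin ler10.
Qed.

(** A further coordinate has to avoid the roots of countably many nonzero
    polynomials, namely those obtained by substituting the coordinates already
    chosen. *)
Lemma alg_independent_exists n : exists h : 'I_n -> R,
  forall f : mpoly n rat, f != 0 -> mmap ratr h f != 0.
Proof.
elim: n => [|n [h hP]].
  exists (fun=> 0) => f f0.
  have mnm_ord0 (m : multinom 0) : m = mnm0 by apply/mnmP => -[].
  have fC : f = mpolyC 0 (mcoeff mnm0 f).
    by apply/mpolyP => m; rewrite mcoeffC (mnm_ord0 m) eqxx mulr1.
  rewrite fC mmapC fmorph_eq0; apply/negP => /eqP c0.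
  by move: f0; rewrite fC c0 mpolyC0 eqxx.
pose bad (s : seq (rat * multinom n.+1)) : set R := [set y |
  mpoly_of_seq s != 0 /\ root (map_poly (mmap ratr h) (muni (mpoly_of_seq s))) y]%classic.
have [|y yP] := @countable_avoid (\bigcup_(s in setT) bad s)%classic.
  apply: bigcup_countable => // s _.
  have [s0|s0] := eqVneq (mpoly_of_seq s) 0.
    by apply: (sub_countable _ (countable0 R)); apply: subset_card_le => y [/eqP].
  apply: finite_set_countable; apply: (sub_finite_set (B := [set y | root (map_poly (mmap ratr h) (muni (mpoly_of_seq s))) y]%classic)).
    by move=> y [].
  apply: finite_roots; have /eqP := muni_neq0 s0; apply: contra_notN => /eqP q0.
  apply/polyP => k; rewrite coef0; apply/eqP; apply: contraT => /hP.
  by rewrite -coef_map q0 coef0 eqxx.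
exists (snoc h y) => f f0; have [s fs] := mpoly_of_seq_surj f.
apply/negP => r; apply: yP; exists s; first by [].
by split; rewrite -fs // /root -mmap_snoc.
Qed.

End Generic.

End AlgebraicIndependence.

Section GenericPosition.
Local Open Scope ring_scope.
Variables (G : sgraph).

Definition coord_eval (K : numFieldType) (q : G -> 'rV[K]_2)
    (f : mpoly #|{: G * 'I_2}| rat) : K :=
  mmap ratr (fun k : 'I_#|{: G * 'I_2}| => q (enum_val k).1 0 (enum_val k).2) f.

(** A polynomial condition holds in generic position as soon as it holds in one
    rational position. *)
Lemma generic_nonvanishing (R : realType) (p : framework R G) f
    (q : G -> 'rV[rat]_2) :
  generic p -> coord_eval q f != 0 -> coord_eval p f != 0.
Proof.
move=> gen qf; apply: gen; apply: contraNneq qf => ->.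
by rewrite /coord_eval mmap0.
Qed.

Definition coordX (v : G) (k : 'I_2) : mpoly #|{: G * 'I_2}| rat :=
  mpolyX rat (mnm1 (enum_rank (v, k))).

Lemma coord_evalX (K : numFieldType) (q : G -> 'rV[K]_2) v k :
  coord_eval q (coordX v k) = q v 0 k.
Proof. by rewrite /coord_eval mmapX mmap1U enum_rankK. Qed.

Lemma coord_evalB (K : numFieldType) (q : G -> 'rV[K]_2) f g :
  coord_eval q (f - g) = coord_eval q f - coord_eval q g.
Proof. exact: mmapB. Qed.

Lemma coord_evalM (K : numFieldType) (q : G -> 'rV[K]_2) f g :
  coord_eval q (f * g) = coord_eval q f * coord_eval q g.
Proof. exact: rmorphM. Qed.

Definition coord_evalE := (coord_evalB, coord_evalM, coord_evalX).

Variables (R : realType) (p : framework R G).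
Hypothesis gen : generic p.

Lemma generic_x (u v : G) : u != v -> p u 0 0 != p v 0 0.
Proof.
move=> uv; rewrite -subr_eq0.
have := @generic_nonvanishing _ p (coordX u 0 - coordX v 0)
   (fun w => const_mx (w == u)%:R) gen.
rewrite !coord_evalE !mxE eqxx [v == u]eq_sym (negbTE uv) subr0; apply.
exact: oner_neq0.
Qed.

Lemma generic_noncollinear (u v w : G) : u != v -> u != w -> v != w ->
  (p u 0 0 - p v 0 0) * (p u 0 1 - p w 0 1) -
  (p u 0 1 - p v 0 1) * (p u 0 0 - p w 0 0) != 0.
Proof.
move=> uv uw vw.
have := @generic_nonvanishing _ p
   ((coordX u 0 - coordX v 0) * (coordX u 1 - coordX w 1) -
    (coordX u 1 - coordX v 1) * (coordX u 0 - coordX w 0))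
   (fun z => \row_k (if k == 0 then (z == v)%:R else (z == w)%:R)) gen.
rewrite !coord_evalE !mxE /= !eqxx (negbTE uv) (negbTE uw) (negbTE vw).
rewrite [w == v]eq_sym (negbTE vw); apply.
by rewrite subrr mul0r subr0 sub0r mulrNN mulr1 oner_neq0.
Qed.
End GenericPosition.

Lemma generic_exists (R : realType) (G : sgraph) :
  exists p : framework R G, generic p.
Proof.
have [h hP] := AlgebraicIndependence.alg_independent_exists R #|{: G * 'I_2}|.
exists (fun v => \row_k h (enum_rank (v, k)))%R => f f0.
have := hP f f0; congr (is_true (negb (_ == _))); apply: eq_bigr => m _.
congr (_ * _)%R; apply: mmap1_eq => k.
by rewrite mxE; congr h; rewrite -surjective_pairing enum_valK.
Qed.

(** * The rigidity matrix *)

(** One dart of each edge: an edge is represented by its forward dart. *)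
Definition forward (G : sgraph) (d : dart G) : bool :=
  enum_rank (source d) < enum_rank (source (opposite d)).

Definition edge_darts (G : sgraph) : {set dart G} := [set d | forward d].

Lemma oppositeK (G : sgraph) : involutive (@opposite G).
Proof. by move=> d; apply: val_inj; rewrite /= -surjective_pairing. Qed.

Lemma dart_ends_neq (G : sgraph) (d : dart G) : source d != source (opposite d).
Proof.
apply/eqP => e; have := svalP d.
by rewrite /source /= in e; rewrite e adj_irr.
Qed.

Lemma forward_opposite (G : sgraph) (d : dart G) :
  forward (opposite d) = ~~ forward d.
Proof.
rewrite /forward oppositeK -leqNgt ltn_neqAle val_eqE (inj_eq enum_rank_inj).
by rewrite eq_sym dart_ends_neq.
Qed.

Lemma opposite_edge_darts (G : sgraph) (d : dart G) :
  (opposite d \in edge_darts G) = (d \notin edge_darts G).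
Proof. by rewrite !inE forward_opposite. Qed.

Definition edges_within (G : sgraph) (A : {set G}) : {set dart G} :=
  [set d in edge_darts G | (source d \in A) && (source (opposite d) \in A)].

Section RigidityMatrix.
Local Open Scope ring_scope.
Variables (R : realType) (G : sgraph) (p : framework R G).
Local Notation n := #|G|.
Local Notation x v := (p v 0 0).
Local Notation y v := (p v 0 1).
Local Notation incidence := (incidence R (@opposite G) (@source G)).

Definition dx (d : dart G) : R := x (source d) - x (source (opposite d)).
Definition dy (d : dart G) : R := y (source d) - y (source (opposite d)).

Definition edge_row (d : dart G) : 'rV[R]_(n + n) :=
  row_mx (\row_i (dx d * incidence d (enum_val i))) (\row_i (dy d * incidence d (enum_val i))).

Definition rigidity_matrix (J : {set dart G}) : 'M[R]_(#|J|, n + n) :=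
  \matrix_(k < #|J|) edge_row (enum_val k).

Definition rigidity_rank (J : {set dart G}) : nat := \rank (rigidity_matrix J).

Local Notation r := rigidity_rank.

Lemma rigidity_matrix_sub (J : {set dart G}) m (M : 'M[R]_(m, n + n)) :
  reflect (forall d, d \in J -> (edge_row d <= M)%MS) (rigidity_matrix J <= M)%MS.
Proof.
apply: (iffP row_subP) => [h d dJ | h i]; last by rewrite rowK h ?enum_valP.
by have := h (enum_rank_in dJ d); rewrite rowK enum_rankK_in.
Qed.

Lemma edge_row_sub (J : {set dart G}) d :
  d \in J -> (edge_row d <= rigidity_matrix J)%MS.
Proof. by move: d; exact: (elimT (rigidity_matrix_sub J _) (submx_refl _)). Qed.

Lemma rigidity_rank_mono (J1 J2 : {set dart G}) : J1 \subset J2 -> (r J1 <= r J2)%N.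
Proof.
move=> s; apply: mxrankS; apply/rigidity_matrix_sub => d dJ.
by apply: edge_row_sub; apply: (subsetP s).
Qed.

Lemma rigidity_rank_card (J : {set dart G}) : (r J <= #|J|)%N.
Proof. exact: rank_leq_row. Qed.

Lemma rigidity_rank_submodular (J1 J2 : {set dart G}) :
  (r (J1 :|: J2) + r (J1 :&: J2) <= r J1 + r J2)%N.
Proof.
rewrite /r -[leqRHS]mxrank_sum_cap; apply: leq_add; apply: mxrankS.
  apply/rigidity_matrix_sub => d; rewrite inE => /orP[] dJ.
    by apply: submx_trans (addsmxSl _ _); apply: edge_row_sub.
  by apply: submx_trans (addsmxSr _ _); apply: edge_row_sub.
apply/rigidity_matrix_sub => d; rewrite inE => /andP[d1 d2].
by rewrite sub_capmx !edge_row_sub.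
Qed.

Lemma sum_inc (d : dart G) (g : G -> R) :
  \sum_(i < n) incidence d (enum_val i) * g (enum_val i) =
  g (source d) - g (source (opposite d)).
Proof.
have E (v : G) : \sum_(i < n) (v == enum_val i)%:R * g (enum_val i) = g v.
  rewrite (bigD1 (enum_rank v)) //= enum_rankK eqxx mul1r big1 ?addr0 // => i iv.
  case: eqP => [e|]; last by rewrite mul0r.
  by rewrite e enum_valK eqxx in iv.
by rewrite -{1}E -E -sumrB; apply: eq_bigr => i _; rewrite /incidence mulrBl.
Qed.

Definition velocities m (g h : G -> 'I_m -> R) : 'M[R]_(n + n, m) :=
  col_mx (\matrix_(i, j) g (enum_val i) j) (\matrix_(i, j) h (enum_val i) j).

Lemma edge_row_mul d m (g h : G -> 'I_m -> R) j :
  (edge_row d *m velocities g h) 0 j =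
  dx d * (g (source d) j - g (source (opposite d)) j) +
  dy d * (h (source d) j - h (source (opposite d)) j).
Proof.
rewrite mul_row_col !mxE -(sum_inc d (g^~ j)) -(sum_inc d (h^~ j)) !mulr_sumr.
by congr (_ + _); apply: eq_bigr => i _; rewrite !mxE mulrA.
Qed.

(** The velocities of the two translations and of the rotation about the
    origin. *)
Definition rigid_x (v : G) (j : 'I_3) : R := [:: 1; 0; - y v]`_j.
Definition rigid_y (v : G) (j : 'I_3) : R := [:: 0; 1; x v]`_j.

Lemma rigid_motion_kernel (J : {set dart G}) :
  rigidity_matrix J *m velocities rigid_x rigid_y = 0.
Proof.
apply/row_matrixP => k; rewrite row_mul rowK row0; apply/rowP => j.
rewrite edge_row_mul mxE /dx /dy /rigid_x /rigid_y.
by case: j => [[|[|[|]]] //= _]; ring.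
Qed.

(** The rows lie in the coordinate space of [A], of dimension [2|A|], and are
    orthogonal to the three rigid motions, which stay independent when
    restricted to [A] because [A] has two points with distinct abscissae. *)
Lemma rigidity_rank_within (A : {set G}) (J : {set dart G}) :
  (forall u v : G, u != v -> x u != x v) ->
  (1 < #|A|)%N ->
  (forall d, d \in J -> (source d \in A) && (source (opposite d) \in A)) ->
  (r J + 3 <= 2 * #|A|)%N.
Proof.
move=> xinj A1 JA.
(* The rows of [U] span the coordinate space of [A]. *)
pose D : 'M[R]_(#|A|, n) := \matrix_(i, j) (enum_val i == enum_val j)%:R.
pose U : 'M[R]_(#|A| + #|A|, n + n) := block_mx D 0 0 D.
have DE (c : R) d : d \in J -> \row_i (c * incidence d (enum_val i)) =
    \row_i (c * incidence d (enum_val i)) *m D.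
  move=> /JA/andP[dA oA]; apply/rowP => j; rewrite !mxE.
  have [jA|jA] := boolP (enum_val j \in A).
    rewrite (bigD1 (enum_rank_in jA (enum_val j))) //= !mxE enum_rankK_in // eqxx.
    rewrite mulr1 big1 ?addr0 // => i ij; rewrite !mxE; case: eqP => [e|].
      by case/eqP: ij; apply: enum_val_inj; rewrite enum_rankK_in.
    by rewrite mulr0.
  rewrite big1 => [|i _]; last first.
    rewrite !mxE; case: eqP => [e|]; last by rewrite mulr0.
    by move: jA; rewrite -e enum_valP.
  rewrite /incidence; do 2!(case: eqP => [e|_]; first by rewrite -e ?dA ?oA in jA).
  by rewrite subrr mulr0.
have JU : (rigidity_matrix J <= U)%MS.
  apply/rigidity_matrix_sub => d dJ.
  apply/submxP; exists (row_mx (\row_i (dx d * incidence d (enum_val i)))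
                               (\row_i (dy d * incidence d (enum_val i)))).
  by rewrite mul_row_block !mulmx0 addr0 add0r -!DE.
have JK : (rigidity_matrix J <= kermx (velocities rigid_x rigid_y))%MS.
  by apply/sub_kermxP; apply: rigid_motion_kernel.
have le : (r J <= \rank (U :&: kermx (velocities rigid_x rigid_y))%MS)%N.
  by apply: mxrankS; rewrite sub_capmx JU.
have := mxrank_mul_ker U (velocities rigid_x rigid_y).
have rU := rank_leq_row U.
suff -> : \rank (U *m velocities rigid_x rigid_y) = 3%N.
  move=> e; rewrite mul2n -addnn; apply: leq_trans rU.
  by rewrite -e addnC leq_add2l.
rewrite -mxrank_tr; apply/eqP; rewrite -[_ == _]/(row_free _) -kermx_eq0.
apply/rowV0P => w /sub_kermxP w0.
have DM (g : G -> 'I_3 -> R) : D *m (\matrix_(i, j) g (enum_val i) j) =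
    \matrix_(i, j) g (enum_val i) j.
  apply/matrixP => i j; rewrite !mxE (bigD1 (enum_rank (enum_val i))) //= !mxE.
  rewrite enum_rankK eqxx mul1r big1 ?addr0 // => k ki; rewrite !mxE.
  case: eqP => [e|]; last by rewrite mul0r.
  by rewrite e enum_valK eqxx in ki.
rewrite mul_block_col !mul0mx addr0 add0r !DM tr_col_mx mul_mx_row in w0.
have w1 := f_equal lsubmx w0; have w2 := f_equal rsubmx w0.
rewrite row_mxKl linear0 in w1; rewrite row_mxKr linear0 in w2.
have e1 v : v \in A -> w 0 0 - w 0 (inord 2) * y v = 0.
  move=> vA; move/rowP: w1 => /(_ (enum_rank_in vA v)); rewrite !mxE.
  rewrite !big_ord_recl big_ord0 !mxE !enum_rankK_in // /rigid_x /= => <-.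
  rewrite mulr1 mulr0 add0r addr0 mulrN; congr (_ - w _ _ * _).
  by apply: val_inj; rewrite /= inordK.
have e2 v : v \in A -> w 0 1 + w 0 (inord 2) * x v = 0.
  move=> vA; move/rowP: w2 => /(_ (enum_rank_in vA v)); rewrite !mxE.
  rewrite !big_ord_recl big_ord0 !mxE !enum_rankK_in // /rigid_y /= => <-.
  rewrite mulr1 mulr0 add0r addr0; congr (w _ _ + w _ _ * _);
  by apply: val_inj; rewrite /= ?inordK.
have /card_gt1P[a [b [aA bA ab]]] := A1.
have w20 : w 0 (inord 2) = 0.
  have /addrI/eqP := etrans (e2 a aA) (esym (e2 b bA)).
  rewrite -subr_eq0 -mulrBr mulf_eq0 subr_eq0 (negbTE (xinj _ _ ab)) orbF.
  by move/eqP.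
have w00 := e1 a aA; have w10 := e2 a aA.
rewrite w20 mul0r subr0 in w00; rewrite w20 mul0r addr0 in w10.
apply/rowP => j; rewrite mxE; case: j => [[|[|[|//]]] lt].
- by apply: (etrans _ w00); congr (w _ _); apply: val_inj.
- by apply: (etrans _ w10); congr (w _ _); apply: val_inj.
- by apply: (etrans _ w20); congr (w _ _); apply: val_inj; rewrite /= inordK.
Qed.

(** The kernel of the rigidity matrix is spanned by the three rigid motions. *)
Lemma rigid_rank : generic p -> generically_rigid R G ->
  (2 * n <= r (edge_darts G) + 3)%N.
Proof.
move=> gen rig; set M := rigidity_matrix (edge_darts G).
have : (kermx M^T <= (velocities rigid_x rigid_y)^T)%MS.
  apply/rV_subP => w /sub_kermxP wM.
  pose m (v : G) : 'rV[R]_2 :=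
    \row_k (if k == 0 then lsubmx w 0 (enum_rank v) else rsubmx w 0 (enum_rank v)).
  have wE : w = (velocities (fun v (_ : 'I_1) => m v 0 0) (fun v _ => m v 0 1))^T.
    rewrite tr_col_mx -[LHS]hsubmxK; congr row_mx; apply/rowP => i;
    by rewrite !mxE /= ?enum_valK.
  have dotM d : dx d * (m (source d) 0 0 - m (source (opposite d)) 0 0) +
                dy d * (m (source d) 0 1 - m (source (opposite d)) 0 1) = 0.
    wlog dE : d / d \in edge_darts G.
      move=> wl; have [dE|dE] := boolP (d \in edge_darts G); first exact: wl.
      rewrite -opposite_edge_darts in dE; have := wl _ dE.
      rewrite /dx /dy oppositeK => <-; ring.
    have /rowP/(_ (enum_rank_in dE d)) := wM; rewrite [RHS]mxE => <-.
    transitivity ((edge_row d *m w^T) 0 0); first by rewrite wE trmxK edge_row_mul.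
    rewrite !mxE; apply: eq_bigr => k _; rewrite !mxE enum_rankK_in //.
    exact: mulrC.
  have mP : infinitesimal_motion p m.
    move=> u v uv; pose d : dart G := exist _ (u, v) uv.
    apply/rowP => k; rewrite ord1 !mxE !big_ord_recl big_ord0 addr0.
    apply: (etrans _ (dotM d)); rewrite /dx /dy /source /=.
    by rewrite !mxE; congr (_ + (_ - _) * (_ - _)); congr (p _ _ _); apply: val_inj.
  have [t [S [St mS]]] := rig p gen m mP.
  have Sjk j k : S j k = - S k j.
    by move/matrixP: St => /(_ k j); rewrite !mxE.
  have S00 k : S k k = 0 by have := Sjk k k; lra.
  have S10 : S 1 0 = - S 0 1 := Sjk 1 0.
  have mE v : (m v 0 0 = t 0 0 - S 0 1 * y v) /\ (m v 0 1 = t 0 1 + S 0 1 * x v).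
    have ord2 (F : 'I_2 -> R) : \sum_i F i = F 0 + F 1.
      rewrite !big_ord_recl big_ord0 addr0; congr (_ + F _); exact: val_inj.
    by split; rewrite mS !mxE ord2 S00 ?S10; ring.
  clearbody m; apply/submxP; exists (\row_(j < 3) [:: t 0 0; t 0 1; S 0 1]`_j).
  rewrite wE !tr_col_mx mul_mx_row; congr row_mx; apply/rowP => i.
    rewrite !mxE !big_ord_recl big_ord0 !mxE /rigid_x /= (mE _).1; ring.
  rewrite !mxE !big_ord_recl big_ord0 !mxE /rigid_y /= (mE _).2; ring.
move=> /mxrankS; rewrite mxrank_ker !mxrank_tr.
have := rank_leq_col (velocities rigid_x rigid_y).
rewrite /r -/M; lia.
Qed.

End RigidityMatrix.

(** An edge is determined by its forward dart. *)
Lemma card_edges_within (H : sgraph) (A : {set H}) :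
  #|induced_edges A| = #|edges_within A|.
Proof.
pose ends (d : dart H) := [set source d; source (opposite d)].
have inj : {in edges_within A &, injective ends}.
  move=> d d'; rewrite !inE => /andP[dE _] /andP[d'E _] e.
  have no b : source d = source (opposite d') ->
      source (opposite d) = source d' -> b.
    by move=> e1 e2; move: dE; rewrite /forward e1 e2 ltnNge (ltnW d'E).
  have s1 : source d \in ends d' by rewrite -e !inE eqxx.
  have s2 : source (opposite d) \in ends d' by rewrite -e !inE eqxx orbT.
  have ne := dart_ends_neq d; apply: val_inj; apply: injective_projections.
    move: s1 s2; rewrite !inE => /orP[/eqP//|/eqP a] /orP[/eqP b|/eqP b].
      exact: no.
    by rewrite a b eqxx in ne.
  move: s1 s2; rewrite !inE => /orP[/eqP a|/eqP a] /orP[/eqP b|/eqP b] //.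
    by rewrite a b eqxx in ne.
  exact: no.
rewrite -(card_in_imset inj); apply: eq_card => e.
apply/imsetP/imsetP => [[[u v] /=]|[d]].
  rewrite inE /= => /and3P[uA vA uv] ->.
  pose d : dart H := exist _ (u, v) uv.
  have [dE|] := boolP (d \in edge_darts H).
    by exists d => //; rewrite inE dE /source /= uA vA.
  rewrite -opposite_edge_darts => dE.
  exists (opposite d); first by rewrite inE dE /source /= uA vA.
  by rewrite /ends /source /= setUC.
rewrite inE => /and3P[_ uA vA] ->.
by exists (val d) => //; rewrite inE uA vA (valP d).
Qed.

Section Nullity.
Variables (R : realType) (G : sgraph) (p : framework R G).
Local Notation r := (rigidity_rank p).
Local Notation EW := (@edges_within G).

Lemma rigidity_corank_mono (J1 J2 : {set dart G}) : J1 \subset J2 ->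
  r J2 + #|J1| <= r J1 + #|J2|.
Proof.
move=> s; have := rigidity_rank_submodular p J1 (J2 :\: J1).
have := rigidity_rank_card p (J2 :\: J1).
rewrite -(cardsID J1 J2) (setIidPr s).
have -> : J1 :|: J2 :\: J1 = J2 by rewrite setDE setUIr setUCr setIT; apply/setUidPr.
lia.
Qed.

Definition nullity (A : {set G}) : nat := #|EW A| - r (EW A).

Lemma nullityE A : nullity A + r (EW A) = #|EW A|.
Proof. by rewrite subnK // rigidity_rank_card. Qed.

(** Adding edges to a set does not decrease its nullity, and the edges within
    [A] together with those within [B] all lie within [A :|: B]. *)
Lemma nullity_supermodular (A B : {set G}) :
  nullity A + nullity B <= nullity (A :|: B) + nullity (A :&: B).
Proof.
have eI : EW A :&: EW B = EW (A :&: B).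
  by apply/setP => d; rewrite !inE; case: (forward d) => //=; rewrite andbACA.
have sU : EW A :|: EW B \subset EW (A :|: B).
  apply/subsetP => d; rewrite !inE; case: (forward d) => //=.
  by case/orP => /andP[-> ->]; rewrite ?orbT.
have := rigidity_corank_mono sU.
have := rigidity_rank_submodular p (EW A) (EW B).
have := cardsUI (EW A) (EW B).
have := nullityE A; have := nullityE B.
have := nullityE (A :|: B); have := nullityE (A :&: B).
rewrite eI; lia.
Qed.

Lemma nullity_edges (A : {set G}) : generic p -> 1 < #|A| ->
  #|induced_edges A| + 3 <= nullity A + 2 * #|A|.
Proof.
move=> gen A1; have := nullityE A; rewrite card_edges_within.
have : r (EW A) + 3 <= 2 * #|A|.
  apply: rigidity_rank_within => // [|d]; first exact: generic_x.
  by rewrite inE => /andP[].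
lia.
Qed.

(** If no edge joined [P] to its complement, the rank would be at most
    [(2|P| - 2) + (2|~: P| - 2)], which is less than [2|V| - 3]. *)
Lemma rigid_connected : generic p -> generically_rigid R G ->
  forall P : {set G}, P != set0 -> P != setT ->
  exists2 d, d \in edge_darts G & (source d \in P) != (source (opposite d) \in P).
Proof.
move=> gen rig P P0 PT.
suff /existsP[d /andP[dE dP]] : [exists d, (d \in edge_darts G) &&
    ((source d \in P) != (source (opposite d) \in P))] by exists d.
apply: contraT; rewrite negb_exists => /forallP no.
have bound (Q : {set G}) : Q != set0 -> r (EW Q) + 2 <= 2 * #|Q|.
  rewrite -card_gt0 => Q0; have [Q1|Q1] := ltnP 1 #|Q|.
    have : r (EW Q) + 3 <= 2 * #|Q|.
      apply: rigidity_rank_within => // [|d]; first exact: generic_x.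
      by rewrite inE => /andP[].
    lia.
  have /eqP/cards1P[v Qv] : #|Q| = 1 by lia.
  have : #|EW Q| = 0.
    apply: eq_card0 => d; apply/negP; rewrite !inE Qv !inE.
    by move=> /and3P[_ /eqP d1 /eqP d2]; have := dart_ends_neq d; rewrite d1 d2 eqxx.
  have := rigidity_rank_card p (EW Q); lia.
have split : edge_darts G = EW P :|: EW (~: P).
  apply/setP => d; have := no d; rewrite !inE; case: (forward d) => //=.
  by rewrite negbK => /eqP->; case: (_ \in P).
have := rigid_rank gen rig; rewrite split.
have := rigidity_rank_submodular p (EW P) (EW (~: P)).
have := bound P P0; have : ~: P != set0.
  by apply: contra PT => /eqP e; rewrite -[P]setCK e setC0.
move/bound; have := cardsC P; lia.
Qed.
End Nullity.


(** * Faces of a connected plane graph *)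

Section Faces.
Variable G : plane_graph.
Local Notation opp := (@opposite G).
Local Notation phi := (next_on_face (@Defs.rot G)).
Local Notation E0 := (edge_darts G).

(** The clockwise rotation; crossing an edge from the left of [d] to the left of
    [opposite d] is the same as turning [d] clockwise ([face_opp]). *)
Definition rotV : {perm dart G} := ((@Defs.rot G)^-1)%g.

Definition face_of (d : dart G) : {set dart G} := [set d' | fconnect phi d d'].

Lemma phi_inj : injective phi.
Proof. by move=> d d' /perm_inj /(can_inj (@oppositeK _)). Qed.

Lemma mem_face (d d' : dart G) : (d' \in face_of d) = (face_of d' == face_of d).
Proof.
have sym := fconnect_sym phi_inj.
rewrite inE; apply/idP/eqP => [c | e].
  by apply/setP => x; rewrite !inE -(same_connect sym c).
have : d' \in face_of d' by rewrite inE connect0.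
by rewrite e inE.
Qed.

Lemma face_of_faces d : face_of d \in faces G.
Proof. exact: imset_f. Qed.

Lemma facesP F : reflect (exists d, F = face_of d) (F \in faces G).
Proof.
by apply: (iffP imsetP) => [[d _ ->]|[d ->]]; exists d.
Qed.

Lemma mem_faces F d : F \in faces G -> (d \in F) = (face_of d == F).
Proof. by case/facesP => d' ->; rewrite mem_face. Qed.

Lemma face_next d : face_of (phi d) = face_of d.
Proof. by apply/eqP; rewrite -mem_face inE fconnect1. Qed.

Lemma face_opp d : face_of (opp d) = face_of (rotV d).
Proof. by rewrite -face_next /next_on_face oppositeK. Qed.

Lemma source_rotV d : source (rotV d) = source d.
Proof.
apply/eqP; rewrite -Defs.rot_cyclic.
by rewrite -{2}[d](permKV (@Defs.rot G)) fconnect1.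
Qed.

Lemma source_next d : source (opp d) = source (phi d).
Proof. by rewrite [RHS]source_rotV. Qed.

(** Each edge is counted once for each of its two sides. *)
Lemma sum_face_card (T : {set {set dart G}}) : T \subset faces G ->
  \sum_(F in T) #|F| = #|[set d in E0 | face_of d \in T]|
    + #|[set d in E0 | face_of (opp d) \in T]|.
Proof.
move=> TF.
transitivity #|[set d | face_of d \in T]|.
  rewrite -sum1_card (partition_big face_of (mem T)) /=; last first.
    by move=> d; rewrite inE.
  apply: eq_bigr => F FT; rewrite -sum1_card; apply: eq_bigl => d.
  rewrite inE (mem_faces _ (subsetP TF F FT)).
  by case: eqP => [->|]; rewrite ?FT ?andbF.
rewrite -(card_imset [set d in E0 | face_of (opp d) \in T] (can_inj (@oppositeK G))).
rewrite -cardsUI [X in _ = _ + X]eq_card0 => [|d].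
  rewrite addn0; apply: eq_card => d; rewrite !inE.
  have -> : (d \in opp @: [set d in E0 | face_of (opp d) \in T]) =
      ~~ forward d && (face_of d \in T).
    rewrite -{1}[d]oppositeK (mem_imset _ _ (can_inj (@oppositeK G))) !inE.
    by rewrite oppositeK forward_opposite.
  by case: (forward d); rewrite ?orbF.
rewrite !inE -{3}[d]oppositeK (mem_imset _ _ (can_inj (@oppositeK G))) !inE.
by rewrite forward_opposite; case: (forward d); rewrite ?andbF.
Qed.

Hypothesis conn : forall P : {set G}, P != set0 -> P != setT ->
  exists2 d, d \in E0 & (source d \in P) != (source (opp d) \in P).

(** If no edge separates [Q] from the other faces, then neither does turning
    around a vertex, so the vertices on the faces of [Q] form a union of
    components. *)
Lemma dual_connected (Q : {set {set dart G}}) :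
  Q != set0 -> Q \proper faces G ->
  exists2 d, d \in E0 & (face_of d \in Q) != (face_of (opp d) \in Q).
Proof.
move=> Q0 QF.
suff /existsP[d /andP[dE dQ]] : [exists d, (d \in E0) &&
    ((face_of d \in Q) != (face_of (opp d) \in Q))] by exists d.
apply: contraT; rewrite negb_exists => /forallP noE.
have same d : (face_of d \in Q) = (face_of (opp d) \in Q).
  wlog dE : d / d \in E0.
    move=> wl; have [|dE] := boolP (d \in E0); first exact: wl.
    by rewrite (wl (opp d)) ?oppositeK // opposite_edge_darts.
  by have := noE d; rewrite dE /= negbK => /eqP.
have sameV d d' : source d = source d' -> (face_of d \in Q) = (face_of d' \in Q).
  move/eqP; rewrite -Defs.rot_cyclic.
  apply: (fconnect_invariant (k := fun e => face_of e \in Q)) => e /=.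
  by rewrite same face_opp /rotV permK eqxx.
pose P := [set v | [exists d, (source d == v) && (face_of d \in Q)]].
have inP d : (source d \in P) = (face_of d \in Q).
  rewrite inE; apply/existsP/idP => [[d' /andP[/eqP /sameV->]]//|dQ].
  by exists d; rewrite eqxx.
have [PT|PT] := eqVneq P setT.
  case/properP: QF => _ [F /facesP[d ->]].
  by rewrite -inP PT inE.
have [|d dE] := conn _ PT; last by rewrite !inP same eqxx.
have [F FQ] := set0Pn _ Q0.
have /facesP[d Fd] : F \in faces G by apply: subsetP FQ; apply: proper_sub.
by apply/set0Pn; exists (source d); rewrite inP -Fd.
Qed.

Hypothesis cardG : 1 < #|G|.

Lemma every_vertex_source v : exists d, @source G d = v.
Proof.
have [||d _] := conn (P := [set v]).
- by apply/set0Pn; exists v; rewrite inE.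
- by apply/eqP => e; move: cardG; rewrite -cardsT -e cards1.
rewrite !inE; have [<-|_] := eqVneq (source d) v; first by exists d.
by rewrite eq_sym eqbF_neg negbK => /eqP <-; exists (opp d).
Qed.

Lemma has_dart : 0 < #|{: dart G}|.
Proof.
have /card_gt0P[v _] : 0 < #|G| by apply: ltnW.
by have [d _] := every_vertex_source v; apply/card_gt0P; exists d.
Qed.

Lemma euler_connected : #|G| + #|faces G| = #|E0| + 2.
Proof.
have := Defs.rot_euler G; rewrite -/(faces G) card_edges_within.
have -> : edges_within [set: G] = E0.
  by apply/setP => d; rewrite inE !in_setT !andbT.
have -> : #|[set v : G | [forall w, ~~ adj v w]]| = 0.
  apply: eq_card0 => v; rewrite inE; apply/negP => /forallP h.
  have [d dv] := every_vertex_source v.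
  by have := h (sval d).2; rewrite -dv (svalP d).
have sym : connect_sym (@adj G) by apply/sym_connect_sym/adj_sym.
have [v0 _] : exists v : G, v \in G.
  by apply/card_gt0P; apply: ltnW.
have -> : n_comp (@adj G) G = 1.
  rewrite -(n_comp_connect sym v0); apply: eq_n_comp_r => v.
  rewrite inE; apply/esym.
  have [e|ne] := eqVneq [set w | connect (@adj G) v0 w] setT.
    by have : v \in setT by []; rewrite -e inE.
  have [|d _] := conn _ ne; first by apply/set0Pn; exists v0; rewrite inE connect0.
  rewrite !inE; suff -> : connect (@adj G) v0 (source d) =
     connect (@adj G) v0 (source (opp d)) by rewrite eqxx.
  rewrite ![connect _ v0 _]sym; apply: same_connect => //.
  by apply: connect1; exact: (svalP d).
by rewrite addn0 muln1.
Qed.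
End Faces.

(** * The rank inequality for a set of faces *)

Section Regions.
Variables (R : realType) (G : plane_graph) (p : framework R G).
Hypothesis gen : generic p.
Hypothesis cardG : 1 < #|G|.
Local Notation opp := (@opposite G).
Local Notation E0 := (edge_darts G).
Local Notation r := (rigidity_rank p).
Local Notation face := (@face_of G).
Hypothesis conn : forall P : {set G}, P != set0 -> P != setT ->
  exists2 d, d \in E0 & (source d \in P) != (source (opp d) \in P).

Definition edges_on (T : {set {set dart G}}) : {set dart G} :=
  [set d in E0 | (face d \in T) || (face (opp d) \in T)].

(** The edges across which the region [T] is regarded as connected. The edges
    within [A] act as walls: their contribution to the rank is given. *)
Definition inner_edges (A : {set G}) (T : {set {set dart G}}) : {set dart G} :=
  [set d in E0 | [&& face d \in T, face (opp d) \in T & d \notin edges_within A]].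

(** All the edges at a surrounded vertex are inner edges of [T]. *)
Definition surrounded (A : {set G}) (T : {set {set dart G}}) : {set G} :=
  [set v | (v \notin A) && [forall d : dart G, (source d == v) ==> (face d \in T)]].

Definition vertices_on (T : {set {set dart G}}) : {set G} :=
  [set v | [exists d : dart G, (source d == v) && (face d \in T)]].

Definition region_connected (A : {set G}) (K : {set {set dart G}}) : Prop :=
  forall T : {set {set dart G}}, T \subset K -> T != set0 -> T != K ->
  exists2 d, d \in inner_edges A K & (face d \in T) != (face (opp d) \in T).

Lemma surroundedP (A : {set G}) T d :
  source d \in surrounded A T -> source d \notin A /\ face d \in T.
Proof.
by rewrite inE => /andP[dA /forallP/(_ d)]; rewrite eqxx.
Qed.

Lemma exits_source (J : {set dart G}) (P : {set G}) : P != setT ->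
  (forall d, d \in E0 -> (source d \in P) || (source (opp d) \in P) -> d \in J) ->
  exits opp (@source G) J P.
Proof.
move=> PT PJ P1 P1P P10.
have [|d dE dP] := conn P10.
  by apply: contraNneq PT => e; rewrite -subTset -e.
exists d => //; apply: PJ => //; move: dP.
have [/(subsetP P1P)->//|_ /=] := boolP (source d \in P1).
by rewrite eq_sym eqbF_neg negbK => /(subsetP P1P)->; rewrite orbT.
Qed.

Lemma exits_face (J : {set dart G}) (Q : {set {set dart G}}) : Q \proper faces G ->
  (forall d, d \in E0 -> (face d \in Q) || (face (opp d) \in Q) -> d \in J) ->
  exits opp face J Q.
Proof.
move=> QF QJ Q1 Q1Q Q10.
have [|d dE dQ] := dual_connected conn Q10; first exact: sub_proper_trans QF.
exists d => //; apply: QJ => //; move: dQ.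
have [/(subsetP Q1Q)->//|_ /=] := boolP (face d \in Q1).
by rewrite eq_sym eqbF_neg negbK => /(subsetP Q1Q)->; rewrite orbT.
Qed.

Lemma exits_region (A : {set G}) K F0 : region_connected A K ->
  F0 \in K -> exits opp face (inner_edges A K) (K :\ F0).
Proof.
move=> cK F0K T TK T0; apply: cK => //.
  by apply: subset_trans TK (subsetDl _ _).
by apply: contraTneq TK => ->; apply/subsetPn; exists F0; rewrite // !inE eqxx.
Qed.

Lemma edges_on_sub T : edges_on T \subset E0.
Proof. by apply/subsetP => d; rewrite inE => /andP[]. Qed.

Lemma inner_edges_sub A T : inner_edges A T \subset E0.
Proof. by apply/subsetP => d; rewrite inE => /andP[]. Qed.

Lemma edge_or_opp d : (d \in E0) || (opp d \in E0).
Proof. by rewrite opposite_edge_darts; case: (d \in E0). Qed.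

Section ConnectedRegion.
Variables (A : {set G}) (K : {set {set dart G}}).
Hypothesis KF : K \subset faces G.
Hypothesis cK : region_connected A K.

Variable F0 : {set dart G}.
Hypothesis F0K : F0 \in K.

(** The boundaries of the faces of [K] are independent cycles of the graph formed
    by the edges on [K], up to one relation if [K] contains all the faces. That
    graph is connected because the region is. *)
Lemma region_euler_edges :
  #|vertices_on K| + #|K| <= #|edges_on K| + (K == faces G) + 1.
Proof.
have /facesP[d0 F0E] := subsetP KF _ F0K.
pose v0 := source d0.
have v0K : v0 \in vertices_on K.
  by rewrite inE; apply/existsP; exists d0; rewrite eqxx -F0E.
(* The only relation between the boundaries of all the faces is that their sum
   vanishes, so one face is removed. *)
pose P := if K == faces G then K :\ F0 else K.
have cP : #|P| + (K == faces G) = #|K|.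
  rewrite /P; case: eqP => _; last by rewrite addn0.
  by rewrite (cardsD1 F0 K) F0K addnC.
have PK : P \subset K by rewrite /P; case: ifP => // _; apply: subsetDl.
have PF : P \proper faces G.
  rewrite /P; case: eqP => [e|/eqP ne]; last by rewrite properEneq ne.
  by rewrite e; apply: properD1; rewrite -e.
have := @incidence_count rat _ opp E0 (@oppositeK G) (@opposite_edge_darts G)
  _ _ face (@source G) _ (@phi_inj G) (@face_next G) (@source_next G)
  P (vertices_on K :\ v0) (edges_on K) (edges_on_sub K).
rewrite (cardsD1 v0 (vertices_on K)) v0K => h.
suff : #|P| + #|vertices_on K :\ v0| <= #|edges_on K| by rewrite -cP; lia.
apply: h.
- move=> d /(subsetP PK) dK.
  by case/orP: (edge_or_opp d) => dE; apply/orP; [left | right];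
    rewrite inE dE ?oppositeK dK ?orbT.
- apply: exits_face => // d dE dP; rewrite inE dE /=.
  by case/orP: dP => /(subsetP PK)->; rewrite ?orbT.
- (* If no edge on [K] leaves [V1], the faces of [K] meeting [V1] are closed
     under crossing edges. *)
  move=> V1 V1K V10.
  suff /existsP[d /andP[dE dV]] : [exists d, (d \in edges_on K) &&
      ((source d \in V1) != (source (opp d) \in V1))] by exists d.
  apply: contraT; rewrite negb_exists => /forallP noE.
  have same d : face d \in K -> (source d \in V1) = (source (opp d) \in V1).
    move=> dK; case/orP: (edge_or_opp d) => dE.
      have := noE d; rewrite inE dE dK /= negbK; exact/eqP.
    have := noE (opp d); rewrite inE dE oppositeK dK orbT /= negbK => /eqP->.
    by [].
  have sameF d d' : face d = face d' -> face d \in K ->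
      (source d \in V1) = (source d' \in V1).
    move=> e dK; have : d' \in face d by rewrite mem_face e.
    rewrite inE => /iter_findex <-.
    elim: (findex _ _ _) => //= k ->; set e' := iter k _ d.
    rewrite -source_next same // (_ : face e' = face d) //.
    rewrite /e'; elim: k {e'} => //= k IH.
    by rewrite face_next.
  pose T := [set F in K | [exists d, (face d == F) && (source d \in V1)]].
  have inT d : face d \in K -> (face d \in T) = (source d \in V1).
    move=> dK; rewrite inE dK /=; apply/existsP/idP => [[d' /andP[/eqP e d'V]]|dV].
      by rewrite -(sameF d') ?e.
    by exists d; rewrite eqxx.
  have [|||d dI dT] := cK (T := T).
  + by apply/subsetP => F; rewrite inE => /andP[].
  + have [v vV] := set0Pn _ V10.
    have := subsetP V1K v vV; rewrite !inE => /andP[_ /existsP[d /andP[/eqP dv dK]]].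
    by apply/set0Pn; exists (face d); rewrite inT // dv.
  + apply/eqP => e; have : v0 \in V1 by rewrite -(inT d0) -F0E // e.
    by move=> /(subsetP V1K); rewrite !inE eqxx.
  move: dI; rewrite inE => /and4P[dE dK oK _].
  by rewrite !inT // same // eqxx in dT.
Qed.

(** The dual statement: the stars of the surrounded vertices are independent
    cycles of the dual graph formed by the faces of [K] and the inner edges. *)
Lemma region_euler_inner :
  #|K| + #|surrounded A K| <= #|inner_edges A K| + (surrounded A K == setT) + 1.
Proof.
have /card_gt0P[d0 _] := has_dart conn cardG.
pose v0 := source d0; set U := surrounded A K.
pose P := if U == setT then U :\ v0 else U.
have cP : #|P| + (U == setT) = #|U|.
  rewrite /P; case: eqP => [->|_]; last by rewrite addn0.
  by rewrite (cardsD1 v0 setT) inE addnC.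
have PU : P \subset U by rewrite /P; case: ifP => // _; apply: subsetDl.
have PT : P != setT.
  rewrite /P; case: ifP => [_|/negbT//]; apply/eqP => /setP/(_ v0).
  by rewrite !inE eqxx.
have UJ d : source d \in U -> d \in E0 -> d \in inner_edges A K.
  move=> dU dE; have [dA dK] := surroundedP dU.
  have [_ oK] : source (rotV G d) \notin A /\ face (rotV G d) \in K.
    by apply: surroundedP; rewrite source_rotV.
  by rewrite inE dE dK face_opp oK /= inE (negbTE dA) andbF.
have UJ' d : source d \in U -> opp d \in E0 -> opp d \in inner_edges A K.
  move=> dU dE; have [dA dK] := surroundedP dU.
  have [_ oK] : source (rotV G d) \notin A /\ face (rotV G d) \in K.
    by apply: surroundedP; rewrite source_rotV.
  by rewrite inE dE oppositeK dK face_opp oK /= inE oppositeK (negbTE dA) !andbF.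
have := @incidence_count rat _ opp E0 (@oppositeK G) (@opposite_edge_darts G)
  _ _ (@source G) face _ (@perm_inj _ (rotV G)) (@source_rotV G) (@face_opp G)
  P (K :\ F0) (inner_edges A K) (inner_edges_sub A K).
rewrite (cardsD1 F0 K) F0K => h.
suff : #|P| + #|K :\ F0| <= #|inner_edges A K|.
  have arith (a b c : nat) (e : bool) : a + b <= c -> true + b + (a + e) <= c + e + 1.
    lia.
  rewrite -cP; exact: arith.
apply: h.
- move=> d /(subsetP PU) dU.
  by case/orP: (edge_or_opp d) => dE; apply/orP; [left; apply: UJ | right; apply: UJ'].
- apply: exits_source => // d dE /orP[] /(subsetP PU) dU; first exact: UJ.
  by rewrite -[d]oppositeK; apply: UJ'; rewrite ?oppositeK.
- exact: exits_region.
Qed.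
Local Open Scope ring_scope.
Local Notation EA := (edges_within A).

(** Euler's formula makes every cycle [f] a boundary; the potential [W] is
    normalised on the face [F0]. *)
Lemma reciprocal_diagram (f : dart G -> R) :
  (forall v, \sum_(d in E0) f d * incidence R opp (@source G) d v = 0) ->
  exists W : {set dart G} -> R, W F0 = 0 /\
    forall d, d \in E0 -> f d = W (face d) - W (face (opp d)).
Proof.
move=> fcyc.
have /card_gt0P[d0 _] := has_dart conn cardG.
pose v0 := source d0; have F0F := subsetP KF _ F0K.
pose z : 'rV[R]_#|E0| := \row_j f (enum_val j).
have /submxP[X zX] : (z <= incidence_mx R opp face (faces G :\ F0) E0)%MS; last first.
  exists (extend0 X); split; first by apply: extend0_out; rewrite !inE eqxx.
  move=> d dE; have /rowP/(_ (enum_rank_in dE d)) := zX.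
  by rewrite mul_incidence_mx !mxE enum_rankK_in.
apply: (@cycle_is_boundary R _ opp E0 (@oppositeK G) (@opposite_edge_darts G)
  _ _ (@source G) face _ (@perm_inj _ (rotV G)) (@source_rotV G) (@face_opp G)
  ([set~ v0])).
- by move=> d _; apply: edge_or_opp.
- apply: exits_source => //; apply/eqP => /setP/(_ v0); by rewrite !inE eqxx.
- by apply: exits_face => //; apply: properD1.
- have := euler_connected conn cardG.
  have arith (a b e : nat) : (1 < a -> a + (true + b) = e + 2 -> a.-1 + b = e)%N.
    lia.
  by rewrite (cardsD1 F0 (faces G)) F0F cardsC1; exact: arith.
- apply/rowP => i; rewrite !mxE -[RHS](fcyc (enum_val i)).
  rewrite [RHS]big_enum_val /=; apply: eq_bigr => j _.
  by rewrite !mxE.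
Qed.

Lemma potential_vanishes (W : {set dart G} -> R) : W F0 = 0 ->
  (forall d, d \in inner_edges A K -> W (face d) = W (face (opp d))) ->
  forall F, F \in K -> W F = 0.
Proof.
move=> W0 WI F FK; pose y F' := if F' \in K then W F' else 0.
suff : y F = 0 by rewrite /y FK.
apply: (exits_vanish (exits_region cK F0K)).
  move=> F'; rewrite !inE negb_and negbK /y => /orP[/eqP->|/negbTE->//].
  by rewrite F0K.
move=> d dI; have := WI d dI; move: dI; rewrite inE => /and4P[_ dK oK _].
by rewrite /y dK oK.
Qed.

(** The edges on [K] within [A] carry no self-stress. A self-stress would have a
    reciprocal diagram [(Wx, Wy)] that vanishes on [K], and around a vertex there
    would be two stressed edges separating [K] from faces with the same nonzero
    value, hence two parallel edges. *)
Lemma boundary_independent :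
  r (edges_on K :&: EA) = #|edges_on K :&: EA|.
Proof.
set J := _ :&: _; apply/eqP; rewrite -[_ == _]/(row_free _) -kermx_eq0.
apply/rowV0P => lam /sub_kermxP lam0.
(* [L] is the stress on forward darts, [Lam] the same stress on all darts. *)
pose L d := extend0 lam d; pose Lam d := L d + L (opp d).
have JE d : d \in J -> d \in E0 by rewrite inE => /andP[/(subsetP (edges_on_sub K))].
have cyc (g : dart G -> R) (D : 'M[R]_(#|J|, #|G|)) :
    (forall k i, D k i = g (enum_val k) * incidence R opp (@source G) (enum_val k) (enum_val i)) ->
    lam *m D = 0 ->
    forall v, \sum_(d in E0) (L d * g d) * incidence R opp (@source G) d v = 0.
  move=> DE D0 v; have /rowP/(_ (enum_rank v)) := D0; rewrite !mxE => e.
  apply: etrans e.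
  rewrite (bigID (mem J)) /= [X in _ + X]big1 ?addr0; last first.
    by move=> d /andP[_ dJ]; rewrite /L extend0_out // !mul0r.
  rewrite (eq_bigl (mem J)); last first.
    by move=> d /=; case: (boolP (d \in J)) => [/JE->|]; rewrite ?andbF.
  rewrite [LHS]big_enum_val /=; apply: eq_bigr => k _.
  by rewrite DE /L extend0_val enum_rankK mulrA.
pose Dx : 'M[R]_(#|J|, #|G|) := \matrix_(k, i) (dx p (enum_val k) *
  incidence R opp (@source G) (enum_val k) (enum_val i)).
pose Dy : 'M[R]_(#|J|, #|G|) := \matrix_(k, i) (dy p (enum_val k) *
  incidence R opp (@source G) (enum_val k) (enum_val i)).
have ME : rigidity_matrix p J = row_mx Dx Dy.
  by apply/row_matrixP => k; rewrite rowK row_row_mx; congr row_mx;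
    apply/rowP => i; rewrite !mxE.
rewrite ME mul_mx_row in lam0.
have lx := f_equal lsubmx lam0; have ly := f_equal rsubmx lam0.
rewrite row_mxKl linear0 in lx; rewrite row_mxKr linear0 in ly.
have cx := cyc (dx p) Dx _ lx; have cy := cyc (dy p) Dy _ ly.
have [Wx [Wx0 WxE]] := reciprocal_diagram (cx (fun k i => mxE _ _ _ _)).
have [Wy [Wy0 WyE]] := reciprocal_diagram (cy (fun k i => mxE _ _ _ _)).
have Lo d : d \in E0 -> L (opp d) = 0.
  move=> dE; apply: extend0_out; apply: contraL dE => /JE.
  by rewrite opposite_edge_darts.
have full (g : dart G -> R) (W : {set dart G} -> R) :
    (forall d, g (opp d) = - g d) ->
    (forall d, d \in E0 -> L d * g d = W (face d) - W (face (opp d))) ->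
    forall d, Lam d * g d = W (face d) - W (face (opp d)).
  move=> gN gW d; case/orP: (edge_or_opp d) => dE.
    by rewrite /Lam Lo // addr0 gW.
  rewrite /Lam -{1}[d]oppositeK Lo // add0r -[LHS]opprK -mulrN -gN gW //.
  by rewrite oppositeK opprB.
have dxN d : dx p (opp d) = - dx p d by rewrite /dx oppositeK opprB.
have dyN d : dy p (opp d) = - dy p d by rewrite /dy oppositeK opprB.
have {}WxE := full _ _ dxN WxE; have {}WyE := full _ _ dyN WyE.
have LamK d : Lam d != 0 -> (face d \in K) || (face (opp d) \in K).
  move=> ld; have : (d \in J) || (opp d \in J).
    apply: contraNT ld; rewrite negb_or => /andP[d1 d2].
    by rewrite /Lam /L !extend0_out ?addr0.
  by case/orP; rewrite !inE ?oppositeK => /andP[/andP[_ //]]; rewrite orbC.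
have LamI d : d \in inner_edges A K -> Lam d = 0.
  rewrite inE => /and4P[dE _ _ dA].
  by rewrite /Lam (Lo d dE) addr0 /L extend0_out // inE (negbTE dA) andbF.
have WK (W : {set dart G} -> R) (g : dart G -> R) : W F0 = 0 ->
   (forall d, Lam d * g d = W (face d) - W (face (opp d))) ->
   forall F, F \in K -> W F = 0.
  move=> W0 WE; apply: potential_vanishes => // d dI.
  by apply/eqP; rewrite -subr_eq0 -WE LamI // mul0r.
have {}Wx0 := WK _ _ Wx0 WxE; have {}Wy0 := WK _ _ Wy0 WyE.
have dx0 d : dx p d != 0 by rewrite subr_eq0; apply: generic_x; rewrite ?dart_ends_neq.
have LamO d : Lam (opp d) = Lam d by rewrite /Lam oppositeK addrC.
suff Lam0 d : Lam d = 0.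
  apply/rowP => k; rewrite mxE -extend0_val -/(L _).
  by have := Lam0 (enum_val k); rewrite /Lam Lo ?addr0 // JE ?enum_valP.
apply/eqP; apply: contraT => ld.
wlog dK : d ld / face d \in K.
  move=> wl; case/orP: (LamK d ld) => dK; first exact: (wl d).
  by apply: (wl (opp d)); rewrite ?LamO.
have w0 : Wx (face (opp d)) != 0.
  have := mulf_neq0 ld (dx0 d); rewrite WxE Wx0 // sub0r oppr_eq0.
  by [].
pose k e := (Wx (face e) == Wx (face (opp d))) && (Wy (face e) == Wy (face (opp d))).
have kd : ~~ k d by rewrite /k Wx0 // eq_sym (negbTE w0).
(* Turning counterclockwise, [e] is the last dart before one whose left face has
   the value of the face to the right of [d]. *)
have [e es /andP[ke kre]] : exists2 e, source e = source d & ~~ k e && k (@Defs.rot G e).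
  suff /existsP[e /and3P[/eqP]] : [exists e, [&& source e == source d, ~~ k e & k (@Defs.rot G e)]].
    by move=> ? ? ?; exists e => //; apply/andP.
  apply: contraT; rewrite negb_exists => /forallP no.
  have sE i : source (iter i (@Defs.rot G) d) = source d.
    by apply/eqP; rewrite eq_sym -Defs.rot_cyclic fconnect_iter.
  have all i : ~~ k (iter i (@Defs.rot G) d).
    elim: i => // i IH; have := no (iter i (@Defs.rot G) d).
    by rewrite sE eqxx IH /=.
  have : fconnect (@Defs.rot G) d (rotV G d).
    by rewrite Defs.rot_cyclic source_rotV.
  move=> /iter_findex rE; have := all (findex (@Defs.rot G) d (rotV G d)).
  by rewrite rE /k -face_opp !eqxx.
set d' := @Defs.rot G e in kre.
have d's : source d' = source d.
  by apply/eqP; rewrite eq_sym -es -Defs.rot_cyclic fconnect1.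
have fo : face (opp d') = face e by rewrite face_opp /rotV /d' permK.
have /andP[/eqP x' /eqP y'] := kre.
have ld' : Lam d' != 0.
  apply: contraNneq ke => l0; have := WxE d'; have := WyE d'.
  rewrite l0 !mul0r fo x' y' /k => /esym/eqP; rewrite subr_eq0 eq_sym => ->.
  by move=> /esym/eqP; rewrite subr_eq0 eq_sym => ->.
have oK : face (opp d') \in K.
  by case/orP: (LamK d' ld') => // fK; move: w0; rewrite -x' Wx0 ?eqxx.
have dd' : d != d'.
  by apply: contraNneq w0 => e'; rewrite -x' -e' Wx0.
have tt : source (opp d) != source (opp d').
  apply: contraNneq dd' => e'; apply/eqP/val_inj.
  by apply: injective_projections; [exact: (esym d's) | exact: e'].
have noncol : dx p d * dy p d' - dy p d * dx p d' != 0.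
  rewrite /dx /dy d's; apply: generic_noncollinear => //.
    exact: dart_ends_neq.
  by rewrite -d's dart_ends_neq.
have Ex := WxE d; have Ey := WyE d; have Ex' := WxE d'; have Ey' := WyE d'.
rewrite (Wx0 _ dK) in Ex; rewrite (Wy0 _ dK) in Ey.
rewrite (Wx0 _ oK) x' in Ex'; rewrite (Wy0 _ oK) y' in Ey'.
case/eqP: noncol; apply: (mulfI (mulf_neq0 ld ld')).
rewrite mulr0 mulrBr mulrACA Ex Ey' [X in _ - X]mulrACA Ey Ex'; ring.
Qed.

Local Close Scope ring_scope.

(** Submodularity of [r] replaces the increase over the edges within [A] by
    [r (edges_on K)] minus the number of independent edges of
    [boundary_independent]. Twice the first Euler inequality plus the second
    one then gives the claim: the relations that are lost if [K] contains all
    the faces are paid for by the outer face. *)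
Lemma region_rank_connected :
  r (EA :|: edges_on K) + #|surrounded A K| + 3 * #|K| <=
  \sum_(F in K) #|F| + 3 * (outer G \in K) + #|edges_on K :\: EA| + r EA.
Proof.
have hE := region_euler_edges; have hI := region_euler_inner.
have hs := rigidity_rank_submodular p EA (edges_on K).
rewrite [EA :&: _]setIC boundary_independent in hs.
have hV : r (edges_on K) + 3 <= 2 * #|vertices_on K|.
  have in_V d : face d \in K -> source d \in vertices_on K.
    by move=> dK; rewrite inE; apply/existsP; exists d; rewrite eqxx.
  have in_V' d : face d \in K -> source (opp d) \in vertices_on K.
    by move=> dK; rewrite source_next; apply: in_V; rewrite face_next.
  apply: rigidity_rank_within => [||d].
  - exact: generic_x.
  - have /facesP[d0 F0E] := subsetP KF _ F0K.
    apply/card_gt1P; exists (source d0), (source (opp d0)).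
    by rewrite in_V -?F0E // in_V' -?F0E // dart_ends_neq.
  rewrite inE => /andP[_ /orP[dK|dK]]; first by rewrite in_V ?in_V'.
  by rewrite -{1}[d]oppositeK in_V' ?in_V.
have hU : (surrounded A K == setT) <= (K == faces G).
  case: eqP => // UT; rewrite lt0b; apply/eqP/setP => F; apply/idP/idP.
    exact: (subsetP KF).
  case/facesP => d ->; apply: (surroundedP (A := A) _).2.
  by rewrite UT inE.
have hO : (K == faces G) <= (outer G \in K).
  case: eqP => // ->; rewrite lt0b; apply: outer_face.
  exact: has_dart conn cardG.
have hS := sum_face_card KF.
have hUI := cardsUI [set d in E0 | face d \in K] [set d in E0 | face (opp d) \in K].
have eU : [set d in E0 | face d \in K] :|: [set d in E0 | face (opp d) \in K] = edges_on K.
  by apply/setP => d; rewrite !inE -andb_orr.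
have lI : #|inner_edges A K| <=
    #|[set d in E0 | face d \in K] :&: [set d in E0 | face (opp d) \in K]|.
  apply/subset_leq_card/subsetP => d.
  by rewrite !inE => /and4P[-> -> -> _].
rewrite eU in hUI; have hD := cardsID EA (edges_on K).
rewrite hS; move: hE hI hs hV hU hO hUI lI hD; clear.
set o := (outer G \in K); set a := (K == _); set b := (_ == setT).
lia.
Qed.
End ConnectedRegion.

End Regions.

Section RegionRank.
Variables (R : realType) (G : plane_graph) (p : framework R G).
Hypothesis gen : generic p.
Hypothesis cardG : 1 < #|G|.
Local Notation opp := (@opposite G).
Local Notation E0 := (edge_darts G).
Local Notation r := (rigidity_rank p).
Local Notation face := (@face_of G).
Local Notation EW := (@edges_within G).

Section Connected.
Hypothesis conn : forall P : {set G}, P != set0 -> P != setT ->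
  exists2 d, d \in E0 & (source d \in P) != (source (opp d) \in P).

(** Every term is additive, or changes in the right direction, when [T] is split
    along walls. In particular all the faces at a surrounded vertex belong to
    the same part. *)
Lemma region_rank (A : {set G}) (T : {set {set dart G}}) : T \subset faces G ->
  r (EW A :|: edges_on T) + #|surrounded A T| + 3 * #|T| <=
  \sum_(F in T) #|F| + 3 * (outer G \in T) + #|edges_on T :\: EW A| + r (EW A).
Proof.
have [k] := ubnP #|T|; elim: k T => // k IH T ltk TF.
have [->|T0] := eqVneq T set0.
  have -> : edges_on (set0 : {set {set dart G}}) = set0.
    by apply/setP => d; rewrite !inE andbF.
  have -> : surrounded A (set0 : {set {set dart G}}) = set0.
    apply/setP => v; rewrite [RHS]inE; apply/negP => vS.
    have [d dv] := every_vertex_source conn cardG v.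
    by rewrite -dv in vS; have [_] := surroundedP vS; rewrite inE.
  by rewrite setU0 !cards0 muln0 !addn0 leq_addl.
pose splits (T1 : {set {set dart G}}) := [&& T1 \subset T, T1 != set0, T1 != T &
  [forall d in inner_edges A T, (face d \in T1) == (face (opp d) \in T1)]].
have [/existsP[T1 /and4P[T1T T10 T1neq /forall_inP T1c]]|] :=
    boolP [exists T1, splits T1]; last first.
  rewrite negb_exists => /forallP cT.
  have [F0 F0T] := set0Pn _ T0.
  apply: (region_rank_connected gen cardG conn TF _ F0T) => T1 T1T T10 T1neq.
  have := cT T1; rewrite /splits T1T T10 T1neq /= negb_forall => /existsP[d].
  by rewrite negb_imply => /andP[dI dT]; exists d.
pose T2 := T :\: T1.
have inT F : F \in T = (F \in T1) || (F \in T2).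
  rewrite !inE; case: (boolP (F \in T1)) => // F1.
  by rewrite (subsetP T1T).
have cT : #|T| = #|T1| + #|T2| by rewrite -(cardsID T1 T) (setIidPr T1T).
have lt1 : #|T1| < k.
  have : 0 < #|T2| by rewrite card_gt0 setD_eq0; apply: contra T1neq => ?; rewrite eqEsubset T1T.
  by move: ltk; lia.
have lt2 : #|T2| < k by move: T10 ltk; rewrite -card_gt0; lia.
have h1 := IH T1 lt1 (subset_trans T1T TF).
have h2 := IH T2 lt2 (subset_trans (subsetDl _ _) TF).
have same d : ~~ ((source d \in A) && (source (opp d) \in A)) ->
    face d \in T -> face (opp d) \in T -> (face d \in T1) = (face (opp d) \in T1).
  wlog dE : d / d \in E0.
    move=> wl; have [|dE] := boolP (d \in E0); first exact: wl.
    move=> dA dT oT; rewrite (wl (opp d)) ?oppositeK ?opposite_edge_darts //.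
    by rewrite andbC.
  move=> dA dT oT; apply/eqP/T1c.
  by rewrite inE dE dT oT inE dE.
have hsum : \sum_(F in T) #|F| = \sum_(F in T1) #|F| + \sum_(F in T2) #|F|.
  rewrite (big_setID T1) /= (setIidPr T1T); by [].
have hout : (outer G \in T : nat) = (outer G \in T1) + (outer G \in T2).
  by rewrite inT inE; case: (_ \in T1); case: (_ \in T).
have hS : #|surrounded A T| <= #|surrounded A T1| + #|surrounded A T2|.
  apply: leq_trans (leq_card_setU _ _); apply/subset_leq_card/subsetP => v vS.
  have [d dv] := every_vertex_source conn cardG v.
  have vA : v \notin A by move: vS; rewrite inE => /andP[].
  have vT d' : source d' = v -> face d' \in T.
    by move=> e; move: vS; rewrite -e => /surroundedP[].
  have turn d' : source d' = v -> (face d' \in T1) = (face (rotV G d') \in T1).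
    move=> d'v; rewrite -face_opp; apply: same.
    - by rewrite d'v (negbTE vA).
    - exact: vT.
    - by rewrite face_opp vT // source_rotV.
  have around d' : source d' = v -> (face d' \in T1) = (face d \in T1).
    move=> d'v; have : fconnect (@Defs.rot G) d d' by rewrite Defs.rot_cyclic dv d'v.
    move=> /iter_findex <-; elim: (findex _ _ _) => //= j <-.
    rewrite turn /rotV ?permK // -dv; apply/eqP.
    by rewrite eq_sym -Defs.rot_cyclic -iterS fconnect_iter.
  rewrite in_setU !inE vA /=; case: (boolP (face d \in T1)) => dT1.
    by apply/orP; left; apply/forallP => d'; apply/implyP => /eqP /around ->.
  apply/orP; right; apply/forallP => d'; apply/implyP => /eqP d'v.
  by rewrite inE around // dT1 vT.
have eU : edges_on T = edges_on T1 :|: edges_on T2.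
  apply/setP => d; rewrite !in_setU !in_set -andb_orr !inT !in_setD.
  by case: (forward d) => //=; do 2!case: (_ \in T1); do 2!case: (_ \in T).
have hD : #|edges_on T :\: EW A| = #|edges_on T1 :\: EW A| + #|edges_on T2 :\: EW A|.
  rewrite eU setDUl -cardsUI [X in _ = _ + X]eq_card0 ?addn0 // => d.
  apply/negP; rewrite !in_setI !in_setD => /andP[/andP[dA d1] /andP[_ d2]].
  have dT : face d \in T /\ face (opp d) \in T -> False.
    case=> dT oT; have dE : d \in E0 := subsetP (edges_on_sub _) d d1.
    rewrite inE dE in dA; have e := same d dA dT oT.
    move: d1 d2; rewrite !in_set e; case/andP => _.
    by rewrite orbb => ->; rewrite andbF.
  have d1' : (face d \in T1) || (face (opp d) \in T1) by move: d1; rewrite inE => /andP[].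
  have d2' : (face d \in T2) || (face (opp d) \in T2) by move: d2; rewrite inE => /andP[].
  have sub1 F : F \in T1 -> F \in T by apply: (subsetP T1T).
  have sub2 F : F \in T2 -> F \in T by rewrite inE => /andP[].
  case/orP: d1' => a1; case/orP: d2' => a2.
  - by move: a2; rewrite inE a1.
  - by apply: dT; split; [apply: sub1 | apply: sub2].
  - by apply: dT; split; [apply: sub2 | apply: sub1].
  - by move: a2; rewrite inE a1.
have hr := rigidity_rank_submodular p (EW A :|: edges_on T1) (EW A :|: edges_on T2).
have hm : r (EW A) <= r ((EW A :|: edges_on T1) :&: (EW A :|: edges_on T2)).
  by apply: rigidity_rank_mono; rewrite subsetI !subsetUl.
have eUU : EW A :|: edges_on T = (EW A :|: edges_on T1) :|: (EW A :|: edges_on T2).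
  by rewrite eU setUACA setUid.
rewrite -eUU in hr; rewrite hsum hout hD cT.
move: h1 h2 hS hr hm; clear.
set o1 := (_ \in T1); set o2 := (_ \in T2); lia.
Qed.

End Connected.
End RegionRank.

(** * The labelling *)

Section Labelling.
Variables (R : realType) (G : plane_graph) (p : framework R G).
Hypothesis gen : generic p.
Hypothesis rig : generically_rigid R G.
Hypothesis cardG : 1 < #|G|.
Local Notation opp := (@opposite G).
Local Notation E0 := (edge_darts G).
Local Notation r := (rigidity_rank p).
Local Notation face := (@face_of G).
Local Notation EW := (@edges_within G).
Let conn := rigid_connected gen rig.

(** The number of big angles demanded by a face; it is never truncated, see
    [big_anglesE]. *)
Definition big_angles (F : {set dart G}) : nat :=
  if F \in faces G then (if F == outer G then #|F| else #|F| - 3) else 0.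

(** A bounded face has at least three angles by [region_rank] for that single
    face, with all the edges acting as walls. *)
Lemma big_anglesE F : F \in faces G ->
  big_angles F + 3 = #|F| + 3 * (F == outer G).
Proof.
move=> FF; rewrite /big_angles FF; case: eqP => [//|/eqP Fo].
have := region_rank gen cardG conn setT (T := [set F]).
rewrite sub1set FF big_set1 cards1 inE eq_sym (negbTE Fo) => /(_ isT).
have -> : EW setT = E0 by apply/setP => d; rewrite inE !in_setT !andbT.
rewrite (setUidPl (edges_on_sub _)).
have -> : edges_on [set F] :\: E0 = set0.
  by apply/eqP; rewrite setD_eq0 edges_on_sub.
rewrite cards0; lia.
Qed.

(** [region_rank] for the faces outside [S]: every vertex that is neither in [A]
    nor on a face of [S] is surrounded by them. Euler's formula and rigidity
    convert one inequality into the other. *)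
Lemma Rado_condition_faces :
  Rado_condition (@source G) face big_angles (nullity p) setT.
Proof.
apply/Rado_conditionP => S A; set V := _ :|: _.
pose T := faces G :\: S; pose S' := faces G :&: S.
have TF : T \subset faces G by apply: subsetDl.
have hT := region_rank gen cardG conn A TF.
have hU : #|G| <= #|V| + #|surrounded A T|.
  rewrite -cardsT; apply: leq_trans (leq_card_setU _ _).
  apply/subset_leq_card/subsetP => v _; rewrite in_setU.
  case: (boolP (v \in V)) => //=; rewrite in_setU negb_or => /andP[vA vS].
  rewrite inE vA; apply/forallP => d; apply/implyP => /eqP dv.
  rewrite inE face_of_faces andbT; apply: contra vS => dS.
  by rewrite -dv; apply: imset_f; rewrite !inE.
have hS : \sum_(F in S) big_angles F + 3 * #|S'| =
    \sum_(F in S') #|F| + 3 * (outer G \in S').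
  have -> : \sum_(F in S) big_angles F = \sum_(F in S') big_angles F.
    rewrite (big_setID (faces G)) /= [X in _ + X]big1 ?addn0 1?setIC // => F.
    by rewrite inE /big_angles => /andP[/negbTE->].
  have -> : 3 * #|S'| = \sum_(F in S') 3 by rewrite sum_nat_const mulnC.
  rewrite -big_split /=.
  have -> : (outer G \in S' : nat) = \sum_(F in S') (F == outer G).
    have [oS|oS] := boolP (outer G \in S').
      rewrite (bigD1 (outer G)) //= eqxx big1 ?addn0 // => F /andP[_].
      by move/negbTE->.
    rewrite big1 // => F FS; apply/eqP; rewrite eqb0.
    by apply: contraNneq oS => <-.
  rewrite big_distrr -big_split /=; apply: eq_bigr => F.
  by rewrite inE => /andP[/big_anglesE].
have hF : \sum_(F in S') #|F| + \sum_(F in T) #|F| = 2 * #|E0|.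
  transitivity (\sum_(F in faces G) #|F|); first by rewrite [RHS](big_setID S).
  rewrite sum_face_card // mul2n -addnn.
  by congr (_ + _); apply: eq_card => d; rewrite inE face_of_faces andbT.
have hO : (outer G \in S') + (outer G \in T) = 1.
  have oF : outer G \in faces G.
    by apply: outer_face; exact: has_dart conn cardG.
  by rewrite !inE oF andbT; case: (_ \in S).
have hC : #|S'| + #|T| = #|faces G| by rewrite cardsID.
have hE := euler_connected conn cardG.
have hR := rigid_rank gen rig.
have sJ : EW A :|: edges_on T \subset E0.
  rewrite subUset edges_on_sub andbT; apply/subsetP => d.
  by rewrite !inE => /andP[].
have hJ := rigidity_corank_mono p sJ.
have hK : #|EW A :|: edges_on T| = #|EW A| + #|edges_on T :\: EW A|.
  rewrite -(cardsID (EW A) (EW A :|: _)) setUK setDUl setDv set0U.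
  by [].
have hN := nullityE p A.
move: hT hU hS hF hO hC hE hR hJ hK hN; clear.
set o1 := (_ \in S'); set o2 := (_ \in T); lia.
Qed.

(** The total demand [c] satisfies [c <= #|source @: N| <= #|N| = c], so the
    vertices of the big angles are distinct. With this, the condition for all
    the faces says that every [A] has at least [nullity p A] non-pointed
    vertices. *)
Lemma rigid_CPT_labelling :
  exists lab : angle G -> bool, CPT_labelling lab /\ generalized_Laman lab.
Proof.
have nu0 : nullity p set0 = 0.
  rewrite /nullity eq_card0 ?sub0n // => d.
  by rewrite inE in_set0 andbF.
have [N RN cN] := Rado_transversal (@nullity_supermodular _ _ p) nu0 Rado_condition_faces.
have /Rado_conditionP {}RN := RN.
have fN : fiber face N setT = N by apply/setP => d; rewrite !inE andbT.
have sizeN : #|N| = \sum_(F in [set: {set dart G}]) big_angles F.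
  rewrite -sum1_card (partition_big face (mem [set: {set dart G}])) /=; last first.
    by move=> d _; rewrite inE.
  apply: eq_bigr => F _; rewrite -cN -sum1_card; apply: eq_bigl => d.
  by rewrite !inE.
have srcN : #|@source G @: N| = #|N|.
  apply/eqP; rewrite eqn_leq leq_imset_card sizeN.
  by have := RN setT set0; rewrite nu0 addn0 set0U fN.
have injN := imset_injP (introT eqP srcN).
have hN (A : {set G}) : nullity p A <= #|A :\: @source G @: N|.
  have := RN setT A; rewrite -sizeN fN -(cardsID (@source G @: N) (A :|: _)).
  rewrite [_ :&: @source G @: N]setIC setKU ?srcN setDUl setDv setU0.
  lia.
exists (fun a => a \in N); split; first split.
- move=> F FF Fo; have := cN F; have := big_anglesE FF; rewrite (negbTE Fo).
  have -> : fiber face N [set F] = F :&: N.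
    by apply/setP => d; rewrite !inE (mem_faces _ FF) andbC.
  have -> : [set a in F | a \notin N] = F :\: N.
    by apply/setP => d; rewrite !inE andbC.
  move=> e1 e2; apply/eqP; rewrite -(eqn_add2l #|F :&: N|) cardsID e2 e1.
  by rewrite muln0 addn0.
- move=> a ao.
  have oF : outer G \in faces G by apply: outer_face; apply/card_gt0P; exists a.
  have := cN (outer G); have := big_anglesE oF; rewrite eqxx.
  have -> : fiber face N [set outer G] = outer G :&: N.
    by apply/setP => d; rewrite !inE (mem_faces _ oF) andbC.
  move=> e1 e2; have /eqP : outer G :&: N == outer G.
    by rewrite eqEcard subsetIl e2 -(leq_add2r 3) e1 muln1 leqnn.
  by move/setP/(_ a); rewrite inE ao.
- move=> v; apply/card_le1_eqP => a b; rewrite !inE.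
  by move=> /andP[/eqP av aN] /andP[/eqP bv bN]; apply: injN; rewrite // av.
move=> A x y xy.
have pointedE v : pointed (fun a => a \in N) v = (v \in @source G @: N).
  apply/existsP/imsetP => [[a /andP[/eqP<- aN]]|[a aN ->]]; exists a => //.
  by rewrite eqxx.
have xE : x = #|A :\: @source G @: N|.
  by apply: eq_card => v; rewrite !inE pointedE andbC.
have yE : y = #|A :&: @source G @: N|.
  by apply: eq_card => v; rewrite !inE pointedE.
have xyA : x + y = #|A| by rewrite xE yE addnC cardsID.
have := nullity_edges (A := A) gen; rewrite -xyA => /(_ xy).
have := hN A; rewrite -xE; lia.
Qed.
End Labelling.

Theorem theorem7 (R : realType) (G : plane_graph) :
  generically_rigid R G ->
  exists lab : angle G -> bool, CPT_labelling lab /\ generalized_Laman lab.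
Proof.
move=> rig; have [p gen] := generic_exists R G.
have [G1|G1] := ltnP 1 #|G|; first exact: rigid_CPT_labelling gen rig G1.
(* With at most one vertex there is no angle, and no set of two vertices. *)
have noD (d : angle G) : False.
  have : #|[set source d; source (opposite d)]| <= 1.
    by apply: leq_trans G1; apply: max_card.
  by rewrite cards2 dart_ends_neq.
exists (fun _ => true); split; first split.
- by move=> F /imsetP[d]; case: (noD d).
- by move=> d; case: (noD d).
- by move=> v; rewrite eq_card0 // => d; case: (noD d).
move=> A x y xy; have : x + y = #|A|.
  rewrite -(cardsID [set v | pointed (fun=> true) v] A) addnC.
  by congr (_ + _); apply: eq_card => v; rewrite !inE // andbC.
by move=> e; move: xy; rewrite e => /leq_trans/(_ (leq_trans (max_card _) G1)).
Qed.
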